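(* Let $\theta\ge2$, $p\in[\theta,\infty)$, and let $L$ be a subspace of $L^p(\mu)\cap C(\Omega)$ for some Borel probability measure $\mu$ on a compact set $\Omega$. Let $B\subset L$ be a symmetric $\theta$-convex (with constant $\zeta>0$) body. Let $m\ge2$ and let $X_1,\ldots,X_m$ be independent random points of $\Omega$ distributed according to $\mu$. Then there is a constant $C=C(p,\theta,\zeta)$, depending only on $p,\theta,\zeta$, such that $$\mathbb{E}\sup_{f\in B}\Bigl|\frac1m\sum_{j=1}^m|f(X_j)|^p-\|f\|_p^p\Bigr|\le C\Bigl(A+A^{\frac1\theta}\bigl(\sup_{f\in B}\mathbb{E}|f(X_1)|^p\bigr)^{1-\frac1\theta}\Bigr),$$ where $$A=\frac{[\log m]^\theta}{m}\,\mathbb{E}\Bigl(\sup_{f\in B}\max_{1\le j\le m}|f(X_j)|^p\Bigr).$$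
   Context: $\|f\|_p:=\bigl(\int_\Omega|f|^p\,d\mu\bigr)^{1/p}$. A norm $\|\cdot\|$ on a linear space $L$ is $\theta$-convex with constant $\zeta>0$ if $\bigl\|\frac{f+g}{2}\bigr\|\le\max(\|f\|,\|g\|)-\zeta\|f-g\|^\theta$ for all $f,g$ with $\|f\|\le1,\|g\|\le1$. A symmetric convex body $B\subset L$ is $\theta$-convex with constant $\zeta$ if it is the unit ball $\{f\in L:\|f\|\le1\}$ of some norm on $L$ which is $\theta$-convex with constant $\zeta$. *)

(* Defs.v *)
From HB Require Import structures.
From mathcomp Require Import all_boot all_order all_algebra.
From mathcomp Require Import all_classical all_reals all_analysis.
From mathcomp Require Import measurable_realfun.

Set Implicit Arguments.
Unset Strict Implicit.
Unset Printing Implicit Defensive.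

Import Order.TTheory GRing.Theory Num.Theory.
Import numFieldNormedType.Exports.

Local Open Scope classical_set_scope.
Local Open Scope ring_scope.

Definition linear_subspace (R : realType) (V : lmodType R) (L : set V) : Prop :=
  GRing.submod_closed (mem L).

(* V will be a space of functions (not of classes of functions modulo equality
   almost everywhere); the axioms constrain N on the subspace L only. *)
Definition norm_on (R : realType) (V : lmodType R) (L : set V) (N : V -> R) :
    Prop :=
  [/\ forall f, L f -> 0 <= N f,
      forall f, L f -> N f = 0 -> f = 0,
      forall (a : R) f, L f -> N (a *: f) = `|a| * N f
    & forall f g, L f -> L g -> N (f + g) <= N f + N g].

Definition theta_convex_norm (R : realType) (V : lmodType R) (L : set V)
    (N : V -> R) (theta zeta : R) : Prop :=
  forall f g, L f -> L g -> N f <= 1 -> N g <= 1 ->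
    N (2^-1 *: (f + g)) <= Num.max (N f) (N g) - zeta * N (f - g) `^ theta.

Definition theta_convex_body (R : realType) (V : lmodType R) (L : set V)
    (theta zeta : R) (B : set V) : Prop :=
  exists N : V -> R, [/\ norm_on L N, theta_convex_norm L N theta zeta
    & B = [set f | L f /\ N f <= 1]].

Notation borel Om := (g_sigma_algebraType (@open Om)).

Definition mutually_independent (R : realType) d (T : measurableType d)
    (P : probability T R) d' (T' : measurableType d') (I : finType)
    (X : I -> {RV P >-> T'}) : Prop :=
  forall (J : {set I}) (A : I -> set T'), (forall j, measurable (A j)) ->
    P (\bigcap_(j in [set` J]) (X j @^-1` A j)) =
    (\prod_(j in J) P (X j @^-1` A j))%E.

(* The expectation of sup_(f in B) Z f in the usual sense of the theory of
   stochastic processes: E sup_B := sup {E sup_F | F finite subset of B}.  When B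
   is uncountable, sup_B Z need not be measurable, and this convention is what
   gives its expectation a meaning over an arbitrary compact space.  Whenever B
   can be replaced by a countable subset it is the plain integral of the supremum
   (Esup_integral_seq), in particular for random samples from a second countable
   space and nonnegative functionals that depend continuously on the sample
   (Esup_integral_second_countable). *)
Definition Esup (R : realType) d (T : measurableType d) (P : probability T R)
    (I : Type) (B : set I) (Z : I -> T -> R) : \bar R :=
  ereal_sup [set (\int[P]_w ereal_sup [set (Z f w)%:E | f in F])%E
            | F in [set F : set I | finite_set F /\ F `<=` B]].

Local Open Scope ereal_scope.

Lemma range_measurable_sup (R : realType) (d : measure_display)
    (T : measurableType d) (I : Type) (Z : I -> T -> R) (u : nat -> I) :
  (forall n, measurable_fun setT (Z (u n))) ->
  measurable_fun setT
    (fun w => ereal_sup [set (Z f w)%:E | f in range u] : \bar R).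
Proof.
move=> mZ.
have -> : (fun w => ereal_sup [set (Z f w)%:E | f in range u]) =
          (fun w => esups (fun n => (Z (u n) w)%:E) 0%N).
  apply/funext => w; rewrite /esups /sdrop /=; congr ereal_sup.
  apply/seteqP; split => [_ [_ [n _ <-] <-]|_ [n _ <-]]; first by exists n.
  by exists (u n) => //; exists n.
apply: measurable_fun_esups => n.
exact/measurable_EFinP.
Qed.

Lemma Esup_integral_seq (R : realType) (d : measure_display)
    (T : measurableType d) (P : probability T R) (I : Type) (B : set I)
    (Z : I -> T -> R) (u : nat -> I) :
  (forall n, B (u n)) ->
  (forall f, B f -> measurable_fun setT (Z f)) ->
  (forall f w, B f -> (0 <= Z f w)%R) ->
  (forall f w, B f ->
     (Z f w)%:E <= ereal_sup [set (Z g w)%:E | g in range u]) ->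
  Esup P B Z = \int[P]_w ereal_sup [set (Z f w)%:E | f in B].
Proof.
move=> Bu mZ Z0 Zu.
have supB w : ereal_sup [set (Z f w)%:E | f in B] =
              ereal_sup [set (Z g w)%:E | g in range u].
  apply/eqP; rewrite eq_le; apply/andP; split.
    by apply: ge_ereal_sup => _ [f Bf <-]; exact: Zu.
  by apply: ereal_sup_le => _ [_ [n _ <-] <-]; exists (u n).
have mB : measurable_fun setT
    (fun w => ereal_sup [set (Z f w)%:E | f in B] : \bar R).
  under eq_fun do rewrite supB.
  by apply: range_measurable_sup => n; exact: mZ.
have sup0 (F : set I) w : F `<=` B -> F !=set0 ->
    0 <= ereal_sup [set (Z f w)%:E | f in F].
  move=> FB [f Ff]; apply: le_ereal_sup_tmp; exists (Z f w)%:E; first by exists f.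
  by rewrite lee_fin Z0//; exact: FB.
apply/eqP; rewrite eq_le; apply/andP; split.
  apply: ge_ereal_sup => _ [F [finF FB] <-].
  have [->|/set0P F0] := eqVneq F set0.
    under eq_integral do rewrite image_set0 ereal_sup0.
    rewrite integral_cst//= probability_setT mule1 leNye //.
  have /pfcard_geP[FE|[v]] := finite_set_countable finF.
    by case: F0 => f; rewrite FE.
  have [u' FE] : exists u' : nat -> I, F = range u'.
    exists v; apply/esym/surj_image_eq; [exact: fun_image_sub|exact: surj].
  apply: ge0_le_integral => //.
  - by move=> w _; exact: sup0.
  - rewrite FE; apply: range_measurable_sup => n; apply/mZ/FB.
    by rewrite FE; exists n.
  - by move=> w _; apply: ereal_sup_le => _ [f Ff <-]; exists f => //; exact: FB.
pose F n : set I := u @` `I_n.+1.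
have FB n : F n `<=` B by move=> _ [k _ <-].
have F0 n : F n !=set0 by exists (u 0%N), 0%N.
have mF n : measurable_fun setT
    (fun w => ereal_sup [set (Z f w)%:E | f in F n] : \bar R).
  have -> : F n = range (fun k => u (minn k n)).
    apply/seteqP; split=> [_ [k kn <-]|_ [k _ <-]].
      by exists k => //; rewrite (minn_idPl _).
    by exists (minn k n) => //=; rewrite ltnS geq_minr.
  by apply: range_measurable_sup => k; exact: mZ.
have ndF w : {homo (fun n => ereal_sup [set (Z f w)%:E | f in F n]) :
    n m / (n <= m)%N >-> n <= m}.
  move=> n m nm; apply: ereal_sup_le => _ [_ [k kn <-] <-].
  exists (u k) => //; exists k => //=.
  by rewrite ltnS in kn *; exact: leq_trans nm.
have limF w : ereal_sup [set (Z f w)%:E | f in B] =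
    limn (fun n => ereal_sup [set (Z f w)%:E | f in F n]).
  rewrite supB; apply/esym/cvg_lim => //.
  have := ereal_nondecreasing_cvgn (ndF w).
  suff -> : ereal_sup [set (Z g w)%:E | g in range u] = ereal_sup
    (range (fun n => ereal_sup [set (Z f w)%:E | f in F n])) by [].
  apply/eqP; rewrite eq_le; apply/andP; split.
    apply: ge_ereal_sup => _ [_ [n _ <-] <-].
    apply: le_ereal_sup_tmp; exists (ereal_sup [set (Z f w)%:E | f in F n]).
      by exists n.
    by apply: ereal_sup_ubound; exists (u n) => //; exists n => /=.
  apply: ge_ereal_sup => _ [n _ <-]; apply: ereal_sup_le => _ [_ [k _ <-] <-].
  by exists (u k) => //; exists k.
under eq_integral do rewrite limF.
rewrite monotone_convergence//; last by move=> n w _; exact: sup0.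
apply: lime_le.
  apply: ereal_nondecreasing_is_cvgn => n m nm.
  apply: ge0_le_integral => //; first by move=> w _; exact: sup0.
  by move=> w _; exact: ndF.
apply: nearW => n; apply: ereal_sup_ubound; exists (F n) => //.
by split=> //; exact/finite_image/finite_II.
Qed.

Local Close Scope ereal_scope.

(* A compact metrizable space is second countable; see
   compact_second_countable in the library. *)
Lemma Esup_integral_second_countable (R : realType) (Om : ptopologicalType)
    (d : measure_display) (T : measurableType d) (P : probability T R)
    (m : nat) (X : 'I_m -> {RV P >-> borel Om}) (I : Type) (B : set I)
    (G : I -> 'rV[Om]_m -> R) :
  @second_countable Om -> B !=set0 ->
  (forall f, B f -> continuous (G f)) ->
  (forall f x, B f -> 0 <= G f x) ->
  let Z f w := G f (\row_j X j w) in
  Esup P B Z = (\int[P]_w ereal_sup [set (Z f w)%:E | f in B])%E.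
Proof.
move=> [b /pfcard_geP cb [bopen bbasis]] [f0 Bf0] cG G0 Z.
have [U Ub UE] : exists2 U : nat -> set Om, (forall n, open (U n)) &
    forall (x : Om) V, nbhs x V -> exists n, U n x /\ U n `<=` V.
  case: cb => [b0|[U]].
    by have [W [/=]] := bbasis point _ filterT; rewrite b0.
  exists U => [n|x V xV]; first by apply: bopen; exact: funS.
  have [W [/= bW Wx] WV] := bbasis x V xV.
  have [n _ UnW] : (range U) W by exact: surj.
  by exists n; rewrite UnW.
pose box (k : {ffun 'I_m -> nat}) : set 'rV[Om]_m :=
  [set x | forall j, U (k j) (x ord0 j)].
have boxP f (c : R) x : B f -> c < G f x ->
    exists k, box k x /\ box k `<=` [set y | c < G f y].
  move=> Bf cx.
  have /= : nbhs x [set y | c < G f y].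
    exact: (cvgr_gt _ (cG f Bf x)).
  case=> Q xQ QG.
  have /choice[k kP] : forall j, exists n, U n (x ord0 j) /\ U n `<=` Q ord0 j.
    by move=> j; apply: UE; exact: xQ.
  exists [ffun j => k j]; split=> [j|y yk].
    by rewrite ffunE; case: (kP j).
  apply: QG => i j; rewrite (ord1 i); apply: (kP j).2.
  by have := yk j; rewrite ffunE.
have mbox k : measurable ((fun w => \row_j X j w : 'rV[Om]_m) @^-1` box k).
  have -> : (fun w => \row_j X j w : 'rV[Om]_m) @^-1` box k =
      \bigcap_(j in [set: 'I_m]) (X j @^-1` U (k j)).
    apply/seteqP; split=> w /= h j; first by move: (h j); rewrite mxE.
    by rewrite mxE; exact: h.
  apply: fin_bigcap_measurable => // j _.
  apply: measurable_funPTI; exact: sub_sigma_algebra.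
have mZ f : B f -> measurable_fun setT (Z f).
  move=> Bf mT; apply: (measurability _ (RGenOInfty.measurableE R)) => //.
  move=> _ [_ [c ->] <-]; rewrite setTI.
  have -> : Z f @^-1` `]c, +oo[ =
     \bigcup_(k in [set k | box k `<=` [set y | c < G f y]])
        ((fun w => \row_j X j w : 'rV[Om]_m) @^-1` box k).
    apply/seteqP; split=> w /=.
      rewrite in_itv/= andbT => /(boxP _ _ _ Bf)[k [kw kG]].
      by exists k.
    by move=> [k kG /kG/=]; rewrite in_itv/= andbT.
  rewrite bigcup_mkcond; apply: countable_bigcupT_measurable => [|k].
    exact: countableP.
  by case: ifP => _.
pose ok (k : {ffun 'I_m -> nat} * rat) f :=
  B f /\ forall x, box k.1 x -> ratr k.2 < G f x.
have /choice[g gP] : forall k, exists f, B f /\ ((exists f', ok k f') -> ok k f).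
  move=> k; have [[f [Bf kf]]|nk] := pselect (exists f, ok k f).
    by exists f.
  by exists f0.
pose u n := if unpickle n is Some k then g k else f0.
apply: (@Esup_integral_seq _ _ _ _ _ _ _ u) => //.
- by move=> n; rewrite /u; case: unpickle => // k; case: (gP k).
- by move=> f w Bf; exact: G0.
move=> f w Bf; rewrite leNgt; apply/negP.
set s := ereal_sup _ => sZ.
have s0 : (0 <= s)%E.
  apply: le_ereal_sup_tmp; exists (Z (u 0%N) w)%:E.
    by exists (u 0%N) => //; exists 0%N.
  rewrite lee_fin G0// /u; case: unpickle => // k; by case: (gP k).
have sfin : s \is a fin_num by rewrite ge0_fin_numE// (lt_trans sZ) ?ltry.
move: sZ; rewrite -(fineK sfin) lte_fin => /rat_in_itvoo[q].
rewrite in_itv/= => /andP[sq qZ].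
have [k [kw kG]] := boxP _ _ _ Bf qZ.
have [_ [|_ /(_ _ kw)/= qg]] := gP (k, q); first by exists f; split.
have : ((Z (g (k, q)) w)%:E <= s)%E.
  apply: ereal_sup_ubound; exists (g (k, q)) => //.
  by exists (pickle (k, q)) => //; rewrite /u pickleK.
rewrite -(fineK sfin) lee_fin leNgt => /negP; apply.
exact: lt_trans qg.
Qed.

(* Main.v *)
Require Import Defs.
From mathcomp Require Import all_boot all_order all_algebra.
From mathcomp Require Import all_classical all_reals all_analysis.
From mathcomp Require Import measurable_realfun.
From mathcomp Require Import ring lra zify.

(** The deviation of the empirical means is symmetrized, and the resulting
    Rademacher process is bounded by a chaining that is built from the
    theta-convexity of the norm [N] of the body.

    Symmetrization. On the product of two copies of the probability space,
    exchanging the two copies of some sample points preserves the joint law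
    ([two_samples_rectangle]); hence the expected deviation of finitely many
    functions is at most twice the expected maximum of the absolute averages
    of [+- |f (X j)|^p], for every choice of signs ([symmetrization]). The
    sample is fixed from now on and only the signs are random.

    Chaining. Divide the values by their supremum over the unit ball.
    Starting from the whole ball, cut it repeatedly: if the function [f] to
    be approximated differs from an element [c] of almost minimal norm of
    the current cell by about [2^-k] at some sample point, restrict the cell
    to the functions that differ from [c] there on the same side. The
    midpoint of [c] and of an element [h] of the new cell stays in the old
    one, so theta-convexity forces [N h >= N c + zeta / 2 * 2^(- k theta)],
    the other half of the gain paying for the slack in the choice of [c]
    ([cell_energy]). As [N f <= 1], the cuts of all scales together satisfy
    [sum 2^(- k theta) <= 2 / zeta] ([nested_words]). Each cut is described
    by one of order [m ln m] letters, so [f] is approximated up to the order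
    of [2^-k] by the centre of a word of length [l_k], with
    [sum_k 2^(- k theta) l_k] bounded.

    The increments [|f|^p - |g|^p] are measured in the norm of [l^theta'],
    [1 / theta + 1 / theta' = 1], in which a Rademacher sum has tails
    [exp (- u^theta)] ([rademacher_max_power]); since [p >= theta] this norm
    is at most a constant times the largest [|f - g|] on the sample times
    [r^(1 - 1 / theta)], where [r] bounds the sums of the powers
    ([powR_dist_le]). A union bound over words gives the link of scale [k]
    the size [2^-k * (l_k ln m)^(1 / theta) * r^(1 - 1 / theta)], and
    summing over the [ln m] relevant scales yields
    [ln m * r^(1 - 1 / theta)] ([rademacher_power_max]).

    Conclusion. The bound [r] of the sums of the powers may be taken as [m]
    times the sum of the largest deviation and the largest mean. After
    Young's inequality with a free parameter has made the bound linear in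
    the peak and in [r], integration gives an inequality with the expected
    deviation on both sides, which is solved in [self_bound]. To have
    measurable suprema, a finite part of the body is first enlarged to the
    rational combinations of its elements that lie in the ball ([ratball]),
    a countable set that contains the centres of all cells. *)

Set Implicit Arguments.
Unset Strict Implicit.
Unset Printing Implicit Defensive.

Import Order.TTheory GRing.Theory Num.Theory.
Import numFieldNormedType.Exports.
Local Open Scope classical_set_scope.
Local Open Scope ring_scope.

(** * Finite maxima *)

Lemma measurable_bigmax (R : realType) d (T : measurableType d) (I : eqType)
    (s : seq I) (g : I -> T -> R) :
  (forall i, i \in s -> measurable_fun setT (g i)) ->
  measurable_fun setT (fun x => \big[Num.max/0]_(i <- s) g i x).
Proof.
elim: s => [_|i s IH mg].
  by under eq_fun do rewrite big_nil; exact: measurable_cst.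
under eq_fun do rewrite big_cons.
apply: measurable_maxr; first by apply: mg; rewrite mem_head.
by apply: IH => k ks; apply: mg; rewrite inE ks orbT.
Qed.

Lemma bigmaxr_le (R : realType) (I : eqType) (s : seq I) (g : I -> R) c :
  0 <= c -> (forall i, i \in s -> g i <= c) -> \big[Num.max/0]_(i <- s) g i <= c.
Proof.
move=> c0 gc; rewrite big_seq; elim/big_ind: _ => // x y xc yc.
by rewrite ge_max xc.
Qed.

Lemma le_bigmaxr (R : realType) (I : eqType) (s : seq I) (g : I -> R) i :
  i \in s -> g i <= \big[Num.max/0]_(i <- s) g i.
Proof.
elim: s => // k s IH; rewrite inE big_cons le_max => /predU1P[->|/IH ->].
  by rewrite lexx.
by rewrite orbT.
Qed.

Lemma bigmaxr_ge0 (R : realType) (I : Type) (s : seq I) (g : I -> R) :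
  0 <= \big[Num.max/0]_(i <- s) g i.
Proof. by elim: s => [|i s IH]; rewrite ?big_nil// big_cons le_max IH orbT. Qed.

Lemma bigmaxrZ (R : realType) (I : Type) (s : seq I) (g : I -> R) c :
  0 <= c -> \big[Num.max/0]_(i <- s) (c * g i) = c * \big[Num.max/0]_(i <- s) g i.
Proof.
move=> c0; elim: s => [|i s IH]; first by rewrite !big_nil mulr0.
by rewrite !big_cons maxr_pMr// IH.
Qed.

(** * Rademacher sums *)

Definition rademacher_sum (R : realType) (m : nat) (e : {ffun 'I_m -> bool})
    (y : 'I_m -> R) : R :=
  \sum_(j < m) (-1) ^+ e j * y j.

Lemma rademacher_sumZ (R : realType) m (e : {ffun 'I_m -> bool}) (c : R) y :
  rademacher_sum e (fun j => c * y j) = c * rademacher_sum e y.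
Proof. by rewrite /rademacher_sum mulr_sumr; apply: eq_bigr => j _; rewrite mulrCA. Qed.

Lemma rademacher_sumD (R : realType) m (e : {ffun 'I_m -> bool}) (y z : 'I_m -> R) :
  rademacher_sum e (fun j => y j + z j) =
  rademacher_sum e y + rademacher_sum e z.
Proof. by rewrite /rademacher_sum -big_split; apply: eq_bigr => j _; rewrite mulrDr. Qed.

Lemma rademacher_sumB (R : realType) m (e : {ffun 'I_m -> bool}) (y z : 'I_m -> R) :
  rademacher_sum e (fun j => y j - z j) =
  rademacher_sum e y - rademacher_sum e z.
Proof. by rewrite /rademacher_sum -sumrB; apply: eq_bigr => j _; rewrite mulrBr. Qed.

Lemma ler_norm_rademacher_sum (R : realType) m (e : {ffun 'I_m -> bool})
    (y : 'I_m -> R) :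
  `|rademacher_sum e y| <= \sum_j `|y j|.
Proof.
apply: le_trans (ler_norm_sum _ _ _) _; apply: ler_sum => j _.
by rewrite normrM normrX normrN1 expr1n mul1r.
Qed.

Lemma sum_signs_const (R : realType) m (c : R) :
  \sum_(e : {ffun 'I_m -> bool}) c = 2 ^+ m * c.
Proof. by rewrite sumr_const card_ffun card_bool card_ord -natrX mulr_natl. Qed.

(** The constant 2 instead of the optimal 1/2 keeps the proof elementary: for small
    [y] compare with the geometric series [1 / (1 - y^2)], otherwise [y <= 2 y^2]. *)
Lemma cosh_le_expR_sqr (R : realType) (y : R) :
  expR y + expR (- y) <= 2 * expR (2 * y ^+ 2).
Proof.
wlog y0 : y / 0 <= y => [H|].
  case: (leP 0 y) => [/H//|y0].
  by have := H (- y); rewrite opprK sqrrN addrC; apply; by rewrite oppr_ge0 ltW.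
have [y2|y2] := lerP (1 / 2) y.
  have : expR y <= expR (2 * y ^+ 2) by rewrite ler_expR; nra.
  have : expR (- y) <= expR (2 * y ^+ 2) by rewrite ler_expR; nra.
  lra.
have expR_le (x : R) : x < 1 -> expR x <= (1 - x)^-1.
  move=> x1; rewrite -[leLHS]invrK -expRN lef_pV2 ?posrE ?expR_gt0 ?subr_gt0//.
  exact: expR_ge1Dx.
have h1 := expR_le y _; have h2 := expR_le (- y) _.
have h3 := expR_ge1Dx (2 * y ^+ 2).
have y4 : 0 <= y ^+ 2 <= 1 / 4 by rewrite expr2; apply/andP; split; nra.
apply: le_trans (lerD (h1 _) (h2 _)) _; [lra|lra|].
apply: (@le_trans _ _ (2 * (1 + 2 * y ^+ 2))); last by lra.
have -> : (1 - y)^-1 + (1 - - y)^-1 = 2 / (1 - y ^+ 2).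
  by field; apply/and3P; split; rewrite gt_eqF//; lra.
by rewrite ler_pdivrMr; nra.
Qed.

Lemma rademacher_mgf (R : realType) m (y : 'I_m -> R) :
  \sum_(e : {ffun 'I_m -> bool}) expR (rademacher_sum e y) <=
  2 ^+ m * expR (2 * \sum_j y j ^+ 2).
Proof.
have -> : \sum_(e : {ffun 'I_m -> bool}) expR (rademacher_sum e y) =
    \prod_(j < m) \sum_(b : bool) expR ((-1) ^+ b * y j).
  rewrite bigA_distr_bigA; apply: eq_bigr => e _.
  by rewrite /rademacher_sum expR_sum.
rewrite mulr_sumr expR_sum.
have -> : (2 : R) ^+ m = \prod_(j < m) 2 by rewrite prodr_const card_ord.
rewrite -big_split /=; apply: ler_prod => j _; rewrite big_bool/=.
rewrite expr0 expr1 mul1r mulN1r addr_ge0 ?expR_ge0//=.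
by rewrite addrC cosh_le_expR_sqr.
Qed.

Lemma rademacher_abs_mgf (R : realType) m (n : R) (y : 'I_m -> R) :
  0 <= n -> n * \sum_j y j ^+ 2 <= 1 ->
  \sum_(e : {ffun 'I_m -> bool}) expR (n * `|rademacher_sum e y|) <=
  2 ^+ m * (2 * expR (2 * n)).
Proof.
move=> n0 ny.
have H (s : R) : `|s| = 1 ->
    \sum_(e : {ffun 'I_m -> bool}) expR (s * n * rademacher_sum e y) <=
    2 ^+ m * expR (2 * n).
  move=> s1; under eq_bigr do rewrite -rademacher_sumZ.
  apply: le_trans (rademacher_mgf _) _; rewrite ler_wpM2l ?exprn_ge0//.
  rewrite ler_expR ler_wpM2l//.
  under eq_bigr do rewrite exprMn.
  rewrite -mulr_sumr exprMn -(real_normK (num_real s)) s1 expr1n mul1r.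
  by rewrite -[leRHS]mulr1 expr2 -mulrA ler_wpM2l.
apply: le_trans (_ : \sum_(e : {ffun 'I_m -> bool})
   (expR (1 * n * rademacher_sum e y) + expR (-1 * n * rademacher_sum e y)) <= _).
  apply: ler_sum => e _.
  case: (ger0P (rademacher_sum e y)) => _.
    by rewrite mul1r lerDl expR_ge0.
  by rewrite mulN1r mulrN mulNr lerDr expR_ge0.
rewrite big_split/=.
have h1 := H 1 (normr1 _); have h2 := H (-1) (normrN1 _); lra.
Qed.

(** A union bound in which each process has its own price: a process of variance at
    most [1 / n] exceeds a large constant with probability of order [expR (- n)].
    Truncation is replaced by [x <= expR x], so that [Q] is an explicit sum of
    exponential moments. *)
Lemma rademacher_max (R : realType) m (I : eqType) (s : seq I)
    (n : I -> R) (y : I -> 'I_m -> R) :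
  (forall c, 1 <= n c) -> (forall c, n c * \sum_j y c j ^+ 2 <= 1) ->
  exists Q : {ffun 'I_m -> bool} -> R,
    [/\ forall e c, c \in s -> `|rademacher_sum e (y c)| <= Q e,
        forall e, 0 <= Q e &
        \sum_e Q e <= 2 ^+ m * (3 + 2 * \sum_(c <- s) expR (- n c))].
Proof.
move=> n1 ny.
have n0 c : 0 <= n c := le_trans ler01 (n1 c).
exists (fun e => 3 + \sum_(c <- s) expR (n c * (`|rademacher_sum e (y c)| - 3))).
split=> [e c cs|e|]; last 2 first.
- by rewrite addr_ge0// sumr_ge0// => c _; exact: expR_ge0.
- rewrite big_split/= sum_signs_const.
  rewrite [leRHS]mulrDr lerD2l exchange_big/= mulr_sumr mulr_sumr; apply: ler_sum => c _.
  under eq_bigr do rewrite mulrBr expRB.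
  rewrite -mulr_suml ler_pdivrMr ?expR_gt0//.
  apply: le_trans (rademacher_abs_mgf (n0 c) (ny c)) _.
  rewrite -!mulrA -expRD ler_wpM2l ?exprn_ge0// ler_wpM2l// ler_expR; lra.
- set r := `|_|; have h : r - 3 <= expR (n c * (r - 3)).
    have [r3|r3] := lerP (r - 3) 0; first exact: le_trans r3 (expR_ge0 _).
    apply: le_trans (_ : n c * (r - 3) <= _).
      by rewrite ler_peMl// ltW.
    by apply: le_trans (expR_ge1Dx _); rewrite lerDr.
  rewrite -lerBlDl; apply: le_trans h _.
  by rewrite (big_rem c)//= lerDl; apply: sumr_ge0 => i _; exact: expR_ge0.
Qed.

(** Rademacher sums have tails [expR (- u^(1 / sg))] with respect to the norm of
    [l^(1 / (1 - sg))], here the normalization [|z| <= bt * t^(1 - sg)] with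
    [t] of sum at most 1.  At the price [n], the coordinates with [t > 1 / n] are
    summed in absolute value and cost [n^sg]; the others have Euclidean norm
    [n^(sg - 1/2)] and are handled by the subgaussian union bound. *)
Lemma rademacher_max_power (R : realType) m (I : eqType) (s : seq I) (sg : R)
    (n bt : I -> R) (t z : I -> 'I_m -> R) :
  0 < sg -> 2 * sg <= 1 ->
  (forall c, 1 <= n c) -> (forall c, 0 <= bt c) ->
  (forall c j, 0 <= t c j) -> (forall c, \sum_j t c j <= 1) ->
  (forall c j, `|z c j| <= bt c * t c j `^ (1 - sg)) ->
  exists Q : {ffun 'I_m -> bool} -> R,
    [/\ forall e c, c \in s -> `|rademacher_sum e (z c)| <= bt c * n c `^ sg * Q e,
     forall e, 0 <= Q e &
    \sum_e Q e <= 2 ^+ m * (4 + 2 * \sum_(c <- s) expR (- n c))].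
Proof.
move=> sg0 sg2 n1 bt0 t0 t1 zbt.
have n0 c : 0 < n c := lt_le_trans ltr01 (n1 c).
pose w c := bt c * n c `^ sg.
have w0 c : 0 <= w c by rewrite mulr_ge0 ?powR_ge0.
(* The small coordinates, rescaled to variance at most 1 / n; for w c = 0 all
   z c j vanish and the division by zero is harmless. *)
pose y c j := if n c * t c j <= 1 then z c j / w c else 0.
have zw c j : w c * (z c j / w c) = z c j.
  have [wc|wc] := eqVneq (w c) 0; last by rewrite mulrCA divff ?mulr1.
  move/eqP: wc; rewrite mulf_eq0 powR_eq0 (gt_eqF (n0 c)) orbF => /eqP b0.
  have := zbt c j; rewrite b0 mul0r normr_le0 => /eqP ->.
  by rewrite mul0r mulr0.
have ny c : n c * \sum_j y c j ^+ 2 <= 1.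
  rewrite mulr_sumr; apply: le_trans (t1 c); apply: ler_sum => j _.
  rewrite /y; case: ifPn => [nt|_]; last by rewrite expr0n mulr0.
  have [tc0|tc0] := eqVneq (t c j) 0.
    have := zbt c j; rewrite tc0 powR0 ?mulr0; last by apply/eqP; lra.
    by rewrite normr_le0 => /eqP ->; rewrite mul0r expr0n mulr0.
  have tp : 0 < t c j by rewrite lt_neqAle eq_sym tc0 t0.
  have [wc|wc] := eqVneq (w c) 0; first by rewrite wc invr0 mulr0 expr0n mulr0 t0.
  have wp : 0 < w c by rewrite lt_neqAle eq_sym wc w0.
  have bp : 0 < bt c.
    by rewrite lt_neqAle bt0 andbT eq_sym; apply: contra_neq wc; rewrite /w => ->; rewrite mul0r.
  have h : `|z c j / w c| <= t c j `^ (1 - sg) / n c `^ sg.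
    rewrite normrM normfV (gtr0_norm wp) ler_pdivrMr// /w.
    rewrite mulrCA -!mulrA mulVf ?mulr1//; last by rewrite gt_eqF ?powR_gt0.
  rewrite -(real_normK (num_real (_ / _))).
  apply: le_trans (_ : n c * (t c j `^ (1 - sg) / n c `^ sg) ^+ 2 <= _).
    by rewrite ler_wpM2l ?(ltW (n0 c))// lerXn2r ?nnegrE// divr_ge0 ?powR_ge0.
  have -> : n c * (t c j `^ (1 - sg) / n c `^ sg) ^+ 2 =
            t c j * (n c * t c j) `^ (1 - 2 * sg).
    rewrite exprMn exprVn -!powR_mulrn ?powR_ge0// -!powRrM powRM ?(ltW (n0 c))//.
    rewrite -powRN.
    rewrite -{1}(powRr1 (ltW (n0 c))) mulrCA -powRD; last by rewrite (gt_eqF (n0 c)) implybT.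
    rewrite -{2}(powRr1 (t0 c j)) mulrA mulrAC -powRD; last by rewrite tc0 implybT.
    by congr (_ `^ _ * _ `^ _); lra.
  rewrite ger_pMr//; rewrite -[leRHS](@powRr0 _ (n c * t c j)).
  apply: ger_powR; last by lra.
  by rewrite nt mulr_gt0.
have [Q [Q1 Q0 Q2]] := rademacher_max s n1 ny.
exists (fun e => 1 + Q e); split.
- move=> e c cs; rewrite -/(w c) mulrDr mulr1.
  have -> : rademacher_sum e (z c) =
    rademacher_sum e (fun j => z c j - w c * y c j) +
    w c * rademacher_sum e (y c).
    rewrite -rademacher_sumZ -rademacher_sumD; apply: eq_bigr => j _.
    by rewrite subrK.
  apply: le_trans (ler_normD _ _) _; apply: lerD; last first.
    by rewrite normrM (ger0_norm (w0 c)) ler_wpM2l// Q1.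
  apply: le_trans (ler_norm_rademacher_sum _ _) _.
  apply: le_trans (_ : \sum_j w c * t c j <= _); last first.
    by rewrite -mulr_sumr ler_piMr.
  apply: ler_sum => j _; rewrite /y; case: ifPn => [_|].
    by rewrite zw subrr normr0 mulr_ge0.
  rewrite -ltNge mulr0 subr0 => nt.
  apply: le_trans (zbt c j) _; rewrite /w -mulrA ler_wpM2l//.
  have tp : 0 < t c j by rewrite -(pmulr_rgt0 _ (n0 c)); exact: lt_trans nt.
  rewrite powRB; last by rewrite (gt_eqF tp) implybT.
  rewrite powRr1// mulrC ler_wpM2r//.
  rewrite -[leLHS]mul1r ler_pdivrMr ?powR_gt0// -powRM ?(ltW (n0 c))//.
  have -> : 1 = 1 `^ sg :> R by rewrite powR1.
  by rewrite ge0_ler_powR ?nnegrE ?(ltW sg0) ?(ltW nt)// ltW// (lt_trans _ nt).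
- by move=> e; rewrite addr_ge0.
rewrite big_split/= sum_signs_const.
have -> : 4 + 2 * \sum_(c <- s) expR (- n c) = 1 + (3 + 2 * \sum_(c <- s) expR (- n c)) :> R by lra.
by rewrite mulrDr mulr1 lerD2l.
Qed.

(** * Cells of a theta-convex class *)

Lemma sumr_seq_const (R : realType) (T : Type) (s : seq T) (c : R) :
  \sum_(l <- s) c = (size s)%:R * c.
Proof. by rewrite big_const_seq count_predT iter_addr addr0 mulr_natl. Qed.

(** The class [B] is seen only through the finitely many values [a f] and the norm
    [N]; the last inequality is theta-convexity after the values have been divided
    by their supremum over the unit ball, so that [|a f j - a g j| <= N (f - g)]. *)
Definition convex_sampling (R : realType) (V : lmodType R) (m : nat)
    (theta zeta : R) (B : set V) (N : V -> R) (a : V -> 'I_m -> R) : Prop :=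
  [/\ B 0 /\ N 0 = 0,
      forall j, a 0 j = 0,
      forall f, B f -> 0 <= N f <= 1 /\ forall j, `|a f j| <= 1
    & forall f g, B f -> B g -> let h := 2^-1 *: (f + g) in
      [/\ B h, forall j, a h j = (a f j + a g j) / 2 &
        forall j, N h <= Num.max (N f) (N g) - zeta * `|a f j - a g j| `^ theta]].

(** An element of almost minimal norm.  Taking 0 whenever possible makes the centre
    of the whole class 0, so that the chain below starts at a process that vanishes;
    the default value 0 keeps the centre of an empty cell in the class. *)
Definition near_min (R : realType) (V : lmodType R) (N : V -> R) (eta : R)
    (K : set V) : V :=
  if `[< K 0 >] then 0
  else xget 0 [set g | K g /\ forall h, K h -> N g <= N h + eta].

Definition scale (R : realType) (k : nat) : R := 2^-1 ^+ k.
Arguments scale {R} k.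

(** What a cut at scale [2^-k] adds to the norm, up to a constant factor. *)
Definition energy (R : realType) (theta : R) (k : nat) : R := scale k `^ theta.

Lemma scale_gt0 (R : realType) k : 0 < scale k :> R.
Proof. by rewrite exprn_gt0// invr_gt0. Qed.

Lemma scale_le (R : realType) k l : (k <= l)%N -> scale l <= scale k :> R.
Proof. by move=> kl; apply: ler_wiXn2l => //; rewrite ?invr_ge0// invf_le1// ler1n. Qed.

Lemma energy_gt0 (R : realType) (theta : R) k : 0 < energy theta k.
Proof. by rewrite powR_gt0// scale_gt0. Qed.

Lemma energy_le (R : realType) (theta : R) k l : 0 <= theta -> (k <= l)%N ->
  energy theta l <= energy theta k.
Proof.
move=> t0 kl; apply: ge0_ler_powR; rewrite ?nnegrE ?(ltW (scale_gt0 _ _))//.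
exact: scale_le.
Qed.

Lemma energy_le1 (R : realType) (theta : R) k : 0 <= theta -> energy theta k <= 1.
Proof.
move=> t0; apply: le_trans (energy_le t0 (leq0n k)) _.
by rewrite /energy /scale expr0 powR1.
Qed.

Lemma energyS (R : realType) (theta : R) k : 1 <= theta ->
  2 * energy theta k.+1 <= energy theta k.
Proof.
move=> t1; rewrite /energy /scale exprS powRM ?invr_ge0 ?exprn_ge0 ?invr_ge0//.
rewrite mulrA ger_pMl ?powR_gt0 ?exprn_gt0 ?invr_gt0//.
rewrite -ler_pdivlMl// mulr1; apply: ge1r_powR => //.
by rewrite invr_gt0 ltr0n/= invf_le1// ler1n.
Qed.

(** A word is a history of cuts, the latest first.  A letter [(k, j, b)] keeps the
    functions that differ from the centre of the current cell by at least
    [2 * 2^-k] at the [j]-th point, in the direction given by [b]. *)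
Fixpoint cell (R : realType) (V : lmodType R) (m K : nat) (eta : R) (B : set V)
    (N : V -> R) (a : V -> 'I_m -> R) (w : seq ('I_K.+1 * 'I_m * bool)) : set V :=
  match w with
  | [::] => B
  | (k, j, b) :: w' =>
      cell eta B N a w' `&`
      [set h | 2 * scale k <=
         (-1) ^+ b * (a h j - a (near_min N eta (cell eta B N a w')) j)]
  end.

Definition cell_center (R : realType) (V : lmodType R) (m K : nat) (eta : R) (B : set V)
    (N : V -> R) (a : V -> 'I_m -> R) (w : seq ('I_K.+1 * 'I_m * bool)) : V :=
  near_min N eta (cell eta B N a w).

Lemma near_minP (R : realType) (V : lmodType R) (N : V -> R) (eta : R)
    (K : set V) : 0 < eta -> N 0 = 0 -> (forall f, K f -> 0 <= N f) ->
  K !=set0 ->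
  K (near_min N eta K) /\ forall h, K h -> N (near_min N eta K) <= N h + eta.
Proof.
move=> eta0 N0 KN Kn; rewrite /near_min; case: asboolP => [K0|_].
  by split=> // h Kh; rewrite N0 addr_ge0 ?KN// ltW.
suff : exists g, K g /\ forall h, K h -> N g <= N h + eta.
  by move=> /(@xgetPex _ 0 [set g | K g /\ forall h, K h -> N g <= N h + eta]).
have hi : has_inf (N @` K).
  split; first by case: Kn => f Kf; exists (N f), f.
  by exists 0 => _ [f Kf <-]; exact: KN.
have [_ [g Kg <-] gi] := inf_adherent eta0 hi.
exists g; split=> // h Kh; apply: le_trans (ltW gi) _.
by rewrite lerD2r; apply: ge_inf; [exact: hi.2|exists h].
Qed.

Lemma cell_sub (R : realType) (V : lmodType R) (m K : nat) (eta : R) (B : set V)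
    (N : V -> R) (a : V -> 'I_m -> R) (w : seq ('I_K.+1 * 'I_m * bool)) f :
  cell eta B N a w f -> B f.
Proof. by elim: w f => //= -[[k j] b] w IH f [/IH]. Qed.

Section tree.
Context (R : realType) (V : lmodType R) (m K : nat) (theta zeta : R)
  (B : set V) (N : V -> R) (a : V -> 'I_m -> R).
Context (theta1 : 1 <= theta) (zeta0 : 0 < zeta)
  (Ba : convex_sampling theta zeta B N a).

Let letter := ('I_K.+1 * 'I_m * bool)%type.
(* Half of the value of the smallest cut, so that at least half of every cut
   survives the slack in the choice of the centre. *)
Let eta := zeta / 2 * energy theta K.
Let cel := cell (K:=K) eta B N a.
Let cen := cell_center (K:=K) eta B N a.

Let theta0 : 0 <= theta. Proof. exact: le_trans ler01 theta1. Qed.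

Let eta0 : 0 < eta.
Proof. by rewrite mulr_gt0 ?energy_gt0// divr_gt0. Qed.

Let cell_near_min w f : cel w f ->
  cel w (cen w) /\ forall h, cel w h -> N (cen w) <= N h + eta.
Proof.
move=> wf; apply: near_minP => //; first by case: Ba => -[].
  by move=> h /cell_sub Bh; case: Ba => _ _ /(_ _ Bh)[/andP[]].
by exists f.
Qed.

Lemma center_in w : B (cen w).
Proof.
suff [->|/cell_sub//] : cen w = 0 \/ cel w (cen w) by case: Ba => -[].
rewrite /cen /cell_center /near_min; case: asboolP => _; first by left.
by case: xgetP => [g _ [Kg _]|_]; [right|left].
Qed.

Let cell_mid w f g : cel w f -> cel w g -> cel w (2^-1 *: (f + g)).
Proof.
elim: w => [|[[k j] b] w IH] /=; first by case: Ba => _ _ _ H Bf Bg; have [] := H f g Bf Bg.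
move=> [wf kf] [wg kg]; split; first exact: IH.
have [_ _ _ /(_ _ _ (cell_sub wf) (cell_sub wg))[_ /(_ j) amid _]] := Ba.
rewrite /= amid; move: kf kg => /=; set c := a (near_min _ _ _) j; rewrite !mulrBr.
by lra.
Qed.

(** Each cut raises the norm: the midpoint of an element of the new cell and of the
    old centre lies in the old cell, where the centre is almost minimal, while
    theta-convexity makes the norm of the midpoint smaller by the cut. *)
Lemma cell_energy w f : cel w f ->
  \sum_(l <- w) zeta / 2 * energy theta l.1.1 <= N f.
Proof.
have [[_ N0] _ Bn Bmid] := Ba.
elim: w f => [|[[k j] b] w IH] f /=.
  by move=> Bf; rewrite big_nil; have [/andP[]] := Bn _ Bf.
move=> [wf kf]; rewrite big_cons/=.
have [wc cmin] := cell_near_min wf.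
have [_ _ /(_ j) ucv] := Bmid _ _ (cell_sub wf) (cell_sub wc).
have cm := cmin _ (cell_mid wf wc).
have far : energy theta k <= `|a f j - a (cen w) j| `^ theta.
  apply: ge0_ler_powR; rewrite ?nnegrE ?(ltW (scale_gt0 _ _))//.
  have : `|a f j - a (cen w) j| = `|(-1) ^+ b * (a f j - a (cen w) j)|.
    by rewrite normrM normrX normrN1 expr1n mul1r.
  move=> ->; apply: le_trans (ler_norm _); apply: le_trans kf.
  by have := scale_gt0 R k; lra.
have eK : eta <= zeta / 2 * energy theta k.
  by rewrite ler_wpM2l ?divr_ge0 ?(ltW zeta0)// energy_le// -ltnS.
have zfar : zeta * energy theta k <= zeta * `|a f j - a (cen w) j| `^ theta.
  by rewrite ler_wpM2l// ltW.
have e0 := energy_gt0 theta k.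
have IHc := IH _ wc.
have ze : 0 < zeta * energy theta k by rewrite mulr_gt0.
move: ucv cm; rewrite /Num.max; case: ifPn => [_|] ucv cm; by lra.
Qed.

Let Bn1 f : B f -> 0 <= N f <= 1.
Proof. by move=> Bf; case: Ba => _ _ /(_ _ Bf)[]. Qed.

(** As long as [f] is far from the centre at some point, one more cut is possible;
    the energy bounds the number of cuts because [N f <= 1]. *)
Lemma refine w f (k : 'I_K.+1) : cel w f ->
  exists u, [/\ cel (u ++ w) f, all (fun l => l.1.1 == k) u &
    forall j, `|a f j - a (cen (u ++ w)) j| <= 2 * scale k].
Proof.
move=> wf; apply: contrapT => nu.
have : forall n, exists u, [/\ cel (u ++ w) f, all (fun l => l.1.1 == k) u & size u = n].
  elim=> [|n [u [uf uk un]]]; first by exists [::].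
  have [j] : exists j, ~ `|a f j - a (cen (u ++ w)) j| <= 2 * scale k.
    by apply/existsNP => H; apply: nu; exists u.
  move=> /negP; rewrite -ltNge => jk.
  exists ((k, j, a f j - a (cen (u ++ w)) j < 0) :: u); rewrite /= un eqxx uk; split=> //.
  split=> //; apply: ltW; apply: lt_le_trans jk _.
  by rewrite -/(cen _) mulr_sign; case: ltrgt0P => // ->.
move=> /(_ (Num.truncn (2 / (zeta * energy theta k))).+1)[u [uf uk un]].
have := cell_energy uf; rewrite big_cat/=.
have -> : \sum_(l <- u) zeta / 2 * energy theta l.1.1 =
    (size u)%:R * (zeta / 2 * energy theta k).
  rewrite -sumr_seq_const; apply: eq_big_seq => l lu.
  by rewrite (eqP (allP uk _ lu)).
rewrite un => le; have := le_trans le (proj2 (andP (Bn1 (cell_sub wf)))).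
have : 0 <= \sum_(l <- w) zeta / 2 * energy theta l.1.1.
  by apply: sumr_ge0 => l _; rewrite mulr_ge0 ?(ltW (energy_gt0 _ _))// divr_ge0// ltW.
have e0 := energy_gt0 theta k.
have ze0 : 0 < zeta * energy theta k by rewrite mulr_gt0.
have : 2 / (zeta * energy theta k) < (Num.truncn (2 / (zeta * energy theta k))).+1%:R.
  by rewrite real_truncnS_gt// num_real.
rewrite ltr_pdivrMr//; set x := _.+1%:R; nra.
Qed.

(** The cuts of all scales share one budget of energy.  Summing the lengths of the
    nested words against the geometric weights [energy theta i] therefore costs no
    more than a constant, which gains a factor equal to the number of scales over
    bounding the length at each scale separately.  The last term on the left makes
    the induction work: it pays for counting [W k] again at the next scale. *)
Lemma nested_words f k : B f -> (k <= K)%N ->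
  exists W : nat -> seq letter,
  [/\ W 0 = [::],
      forall i, (i < k)%N -> (size (W i) <= size (W i.+1))%N,
      cel (W k) f,
      forall i j, (i <= k)%N -> `|a f j - a (cen (W i)) j| <= 2 * scale i &
      \sum_(i < k.+1) energy theta i * (size (W i))%:R +
        energy theta k * (size (W k))%:R <=
      2 * \sum_(l <- W k) energy theta l.1.1].
Proof.
move=> Bf; elim: k => [_|k IH kK].
  exists (fun=> [::]); split=> //.
    move=> [|//] j _; rewrite /scale expr0 mulr1.
    apply: le_trans (ler_normB _ _) _.
    have [_ _ Bn _] := Ba.
    have [_ /(_ j)] := Bn _ Bf; have [_ /(_ j)] := Bn _ (center_in [::]).
    by rewrite -/cen; lra.
  by rewrite big_ord1/= big_nil !mulr0 addr0.
have [W [W0 Wmon Wf Wnear We]] := IH (ltnW kK).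
have [u [uf uk unear]] := refine (Ordinal (kK : (k.+1 < K.+1)%N)) Wf.
exists (fun i => if (i <= k)%N then W i else u ++ W k); split=> //.
- move=> i; rewrite ltnS => ik; rewrite ik; case: ltnP => ik'; first exact: Wmon.
  have -> : i = k by apply/eqP; rewrite eqn_leq ik.
  by rewrite size_cat leq_addl.
- by rewrite ltnn.
- by move=> i j ik1; case: ifPn => [/Wnear//|]; rewrite -ltnNge => ik;
    have -> : i = k.+1 by apply/eqP; rewrite eqn_leq ik1.
rewrite big_ord_recr/= ltnn big_cat/=.
have -> : \sum_(i < k.+1) energy theta i * (size (if (i <= k)%N then W i else u ++ W k))%:R
    = \sum_(i < k.+1) energy theta i * (size (W i))%:R.
  by apply: eq_bigr => i _; rewrite -ltnS ltn_ord.
have -> : \sum_(l <- u) energy theta l.1.1 = (size u)%:R * energy theta k.+1.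
  rewrite -sumr_seq_const; apply: eq_big_seq => l lu.
  by rewrite (eqP (allP uk _ lu)).
have := energyS k theta1; rewrite size_cat natrD.
have := energy_gt0 theta k.+1; have := ler0n R (size u); have := ler0n R (size (W k)).
move: We.
set S := \sum_(i < k.+1) _; set S' := \sum_(l <- W k) _.
move=> We wk su ek ek2.
have : 2 * energy theta k.+1 * (size (W k))%:R <= energy theta k * (size (W k))%:R.
  by rewrite ler_wpM2r.
lra.
Qed.
End tree.

(** * Powers, words and logarithms *)

(** This is Young's inequality for [y] and [x `^ (p - 1)]. *)
Lemma powR_diff_le (R : realType) (p x y : R) : 1 <= p -> 0 <= y -> y <= x ->
  x `^ p - y `^ p <= p * (x - y) * x `^ (p - 1).
Proof.
move=> p1 y0 yx; have x0 := le_trans y0 yx.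
have [->|pn1] := eqVneq p 1.
  by rewrite subrr powRr0 mulr1 !powRr1// mul1r.
have p2 : 1 < p by rewrite lt_neqAle eq_sym pn1.
have p0 : 0 < p by lra.
have pp : 0 < p - 1 by lra.
have := @conjugate_powR R y (x `^ (p - 1)) p (p / (p - 1)) y0 (powR_ge0 _ _).
have -> : x `^ (p - 1) `^ (p / (p - 1)) = x `^ p.
  by rewrite -powRrM mulrCA divff ?mulr1// gt_eqF.
move=> /(_ p0 (divr_gt0 p0 pp)) Y.
have {}Y : y * x `^ (p - 1) <= y `^ p / p + x `^ p / (p / (p - 1)).
  by apply: Y; field; rewrite !gt_eqF.
have xp : x * x `^ (p - 1) = x `^ p by rewrite mulr_powRB1.
have -> : p * (x - y) * x `^ (p - 1) = p * (x `^ p) - p * (y * x `^ (p - 1)).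
  by rewrite -xp; ring.
have := ler_wpM2l (ltW p0) Y.
have -> : p * (y `^ p / p + x `^ p / (p / (p - 1))) = y `^ p + x `^ p * (p - 1).
  by field; rewrite !gt_eqF.
lra.
Qed.

(** On the unit interval the exponent [p - 1] may be lowered to [p * (1 - sg)]; this is where
    [p >= theta] enters, with [sg = theta^-1]. *)
Lemma powR_dist_le (R : realType) (sg p x y : R) : 1 <= p -> 1 <= p * sg -> sg <= 1 ->
  0 <= x <= 1 -> 0 <= y <= 1 ->
  `|x `^ p - y `^ p| <= p * `|x - y| * (x `^ p + y `^ p) `^ (1 - sg).
Proof.
move=> p1 psg sg1; wlog yx : x y / y <= x => [H hx hy|].
  have [/H->//|/ltW/H] := leP y x.
  by rewrite distrC (distrC y) (addrC (y `^ p)); apply.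
move=> /andP[x0 x1] /andP[y0 y1].
have p0 : 0 <= p by lra.
rewrite (ger0_norm (_ : 0 <= x - y)) ?subr_ge0//.
rewrite ger0_norm ?subr_ge0; last exact: ge0_ler_powR.
have [x00|xn0] := eqVneq x 0.
  have -> : y = x by apply/eqP; rewrite eq_le yx x00 y0.
  by rewrite !subrr mulr0 mul0r.
apply: le_trans (powR_diff_le p1 y0 yx) _.
rewrite ler_wpM2l ?mulr_ge0 ?subr_ge0//.
apply: le_trans (_ : x `^ p `^ (1 - sg) <= _); last first.
  have xy0 : 0 <= x `^ p + y `^ p by rewrite addr_ge0 ?powR_ge0.
  by apply: ge0_ler_powR; rewrite ?nnegrE ?subr_ge0 ?lerDl ?powR_ge0.
rewrite -powRrM; apply: ger_powR; last by lra.
by rewrite x1 lt_neqAle eq_sym xn0 x0.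
Qed.

Lemma ln2_ge (R : realType) : 1 / 2 <= ln 2 :> R.
Proof.
rewrite -ler_expR lnK ?posrE//.
have h := expR_ge1Dx (- (1 / 2) : R); have e0 := expR_gt0 (1 / 2 : R).
have : expR (1 / 2) * expR (- (1 / 2)) = 1 :> R by rewrite -expRD subrr expR0.
nra.
Qed.

Definition words (T : finType) (L : nat) : seq (seq T) :=
  flatten [seq [seq tval t | t : l.-tuple T] | l <- iota 0 L].

Lemma mem_words (T : finType) L (w : seq T) : (size w < L)%N -> w \in words T L.
Proof.
move=> wL; apply/flattenP; exists [seq tval t | t : (size w).-tuple T].
  by apply/mapP; exists (size w) => //; rewrite mem_iota.
by apply/mapP; exists (in_tuple w) => //; rewrite mem_enum.
Qed.

(** The factor 2 gives all words of length [l] together the weight [2^- l]. *)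
Lemma sum_words (R : realType) (T : finType) L : (0 < #|T|)%N ->
  \sum_(w <- words T L) expR (- (ln (2 * #|T|%:R) * (size w)%:R)) <= 2 :> R.
Proof.
move=> T0; have q0 : 0 < #|T|%:R :> R by rewrite ltr0n.
rewrite big_flatten big_map.
have -> : \sum_(l <- iota 0 L) \sum_(w <- [seq tval t | t : l.-tuple T])
   expR (- (ln (2 * #|T|%:R) * (size w)%:R)) = \sum_(0 <= l < L) (2^-1) ^+ l :> R.
  rewrite /index_iota subn0; apply: eq_bigr => l _.
  rewrite big_map big_enum/=; under eq_bigr do rewrite size_tuple.
  rewrite sumr_const card_tuple -[LHS]mulr_natl natrX expRN expRM_natr lnK ?posrE ?mulr_gt0//.
  by rewrite exprMn exprVn invfM mulrCA divff ?mulr1// expf_neq0// gt_eqF.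
have -> : \sum_(0 <= l < L) (2^-1) ^+ l = 2 - 2 * (2^-1) ^+ L :> R.
  elim: L => [|L IH]; first by rewrite big_geq// expr0 mulr1 subrr.
  by rewrite big_nat_recr//= IH exprS; field.
by rewrite gerBl mulr_ge0// exprn_ge0// invr_ge0.
Qed.

Lemma energy_root (R : realType) (theta : R) k : 1 <= theta ->
  energy theta k `^ theta^-1 = scale k.
Proof.
move=> t1; rewrite -powRrM divff ?powRr1//; first exact: ltW (scale_gt0 _ _).
by rewrite gt_eqF//; lra.
Qed.

(** This crude bound replaces Hoelder's inequality in the summation over scales: it
    loses only the number of scales, which is of the order of [ln m] like the price
    of a letter. *)
Lemma powR_le1D (R : realType) (x s : R) : 0 <= x -> 0 <= s <= 1 -> x `^ s <= 1 + x.
Proof.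
move=> x0 /andP[s0 s1]; have [x1|x1] := leP x 1.
  apply: le_trans (_ : 1 `^ s <= _); last by rewrite powR1 lerDl.
  by apply: ge0_ler_powR; rewrite ?nnegrE.
apply: le_trans (ler1_powR (ltW x1) s1) _; lra.
Qed.

(** With this number [K] of scales the finest scale is below [1 / m], and both [K] and
    the price of a letter are of the order of [ln m]. *)
Lemma log_parameters (R : realType) (m : nat) : (1 < m)%N ->
  let K := (trunc_log 2 m).+1 in
  [/\ 1 / 2 <= ln m%:R :> R, m%:R * scale K <= 1 :> R, K%:R <= 4 * ln m%:R :> R &
    ln (2 * (K.+1 * m * 2)%:R) <= 5 * ln m%:R :> R].
Proof.
move=> m1 K; have m0 : (0 < m)%N := ltnW m1.
have m0' : 0 < m%:R :> R by rewrite ltr0n.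
have l2 := ln2_ge R.
have lm : ln 2 <= ln m%:R :> R by rewrite ler_ln ?posrE// ler_nat.
split.
- exact: le_trans lm.
- rewrite /scale exprVn ler_pdivrMr ?exprn_gt0// mul1r -natrX ler_nat ltnW//.
  exact: trunc_log_ltn.
- have : (trunc_log 2 m)%:R * ln 2 <= ln m%:R :> R.
    rewrite mulr_natl -lnXn//; rewrite ler_ln ?posrE ?exprn_gt0//.
    by rewrite -natrX ler_nat trunc_logP.
  rewrite /K -natr1; have := ler0n R (trunc_log 2 m); nra.
- rewrite [leRHS]mulr_natl -lnXn// ler_ln ?posrE ?exprn_gt0//; last first.
    by rewrite mulr_gt0// ltr0n !muln_gt0 m0.
  rewrite -natrX -natrM ler_nat.
  have Km : (trunc_log 2 m < m)%N.
    by apply: leq_trans (trunc_logP (isT : (1 < 2)%N) m0); rewrite ltn_expl.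
  apply: (@leq_trans (8 * m ^ 2)); rewrite /K.
    rewrite expnS expn1; nia.
  have : (8 * m ^ 2 <= m ^ 3 * m ^ 2)%N by rewrite leq_mul2r -[8%N]/(2 ^ 3)%N leq_exp2r// m1 orbT.
  by rewrite -expnD.
Qed.

(** * Chaining *)

Section power_process.
Context (R : realType) (theta p zeta : R).
Context (theta2 : 2 <= theta) (thetap : theta <= p) (zeta0 : 0 < zeta).
Context (V : lmodType R) (m : nat) (B : set V) (N : V -> R) (a : V -> 'I_m -> R).
Context (m1 : (1 < m)%N) (Ba : convex_sampling theta zeta B N a).
Context (r : R) (r0 : 0 < r) (Br : forall f, B f -> \sum_j `|a f j| `^ p <= r).

Let sg := theta^-1.
Let K := (trunc_log 2 m).+1.
Let lam : R := ln m%:R.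
Let letter : finType := ('I_K.+1 * 'I_m * bool)%type.
Let Lam : R := ln (2 * #|letter|%:R).
Let eta := zeta / 2 * energy theta K.
Let cen := cell_center (K:=K) eta B N a.
Let h (f : V) (j : 'I_m) : R := `|a f j| `^ p.
Let dist (f g : V) : R := \big[Num.max/0]_j `|a f j - a g j|.
Let D : R := (2 * r) `^ (1 - sg).
Let t (f g : V) (j : 'I_m) : R := (h f j + h g j) / (2 * r).

Let theta1 : 1 <= theta. Proof. by apply: le_trans theta2; rewrite ler1n. Qed.
Let p1 : 1 <= p. Proof. exact: le_trans thetap. Qed.
Let p0 : 0 <= p. Proof. exact: le_trans p1. Qed.
Let th0 : 0 < theta. Proof. exact: lt_le_trans theta1. Qed.
Let sg0 : 0 < sg. Proof. by rewrite invr_gt0. Qed.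
Let sgt : sg * theta = 1. Proof. by rewrite mulVf// gt_eqF. Qed.
Let sg2 : 2 * sg <= 1. Proof. by rewrite mulrC -[leRHS]sgt ler_wpM2l// ltW. Qed.
Let psg : 1 <= p * sg. Proof. by rewrite mulrC -[leLHS]sgt ler_wpM2l// ltW. Qed.
Let sg1 : sg <= 1. Proof. by rewrite invf_le1. Qed.
Let D0 : 0 <= D. Proof. exact: powR_ge0. Qed.
Let r20 : 0 < 2 * r. Proof. by rewrite mulr_gt0. Qed.
Let h0 f j : 0 <= h f j. Proof. exact: powR_ge0. Qed.
Let t0 f g j : 0 <= t f g j. Proof. by rewrite divr_ge0 ?addr_ge0 ?(ltW r20). Qed.
Let dist0 f g : 0 <= dist f g. Proof. exact: bigmaxr_ge0. Qed.

Let dist_ge f g j : `|a f j - a g j| <= dist f g.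
Proof. exact: (le_bigmaxr (fun j => `|a f j - a g j|) (mem_index_enum j)). Qed.

Let dist_le f g (x : R) : 0 <= x -> (forall j, `|a f j - a g j| <= x) -> dist f g <= x.
Proof. by move=> x0 fg; apply: bigmaxr_le. Qed.

Let card_letter : #|letter| = (K.+1 * m * 2)%N.
Proof. by rewrite !card_prod !card_ord card_bool. Qed.

Let letter_gt0 : (0 < #|letter|)%N.
Proof. by rewrite card_letter !muln_gt0/= ltnW. Qed.

Let Lam0 : 0 <= Lam.
Proof. by rewrite ln_ge0// -natrM ler1n muln_gt0/=. Qed.

Let cenB w : B (cen w). Proof. exact: center_in. Qed.

Let aabs f j : B f -> 0 <= `|a f j| <= 1.
Proof. by have [_ _ Bn _] := Ba; move=> /Bn[_ ->]; rewrite normr_ge0. Qed.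

Let N1 f : B f -> N f <= 1.
Proof. by have [_ _ Bn _] := Ba; move=> /Bn[/andP[]]. Qed.

Let t1 f g : B f -> B g -> \sum_j t f g j <= 1.
Proof.
move=> Bf Bg; rewrite -mulr_suml ler_pdivrMr// mul1r big_split/=.
by apply: le_trans (lerD (Br Bf) (Br Bg)) _; rewrite mulr_natl.
Qed.

(** The increments of the process in the normal form of [rademacher_max_power]: the
    weights [t] depend on both functions and have sum at most 1, and the scale is
    governed by the largest difference at the sample points. *)
Let power_increment f g j : B f -> B g ->
  `|h f j - h g j| <= p * dist f g * D * t f g j `^ (1 - sg).
Proof.
move=> Bf Bg; rewrite -mulrA -powRM ?(ltW r20)//.
rewrite /t mulrCA divff ?gt_eqF// mulr1.
apply: le_trans (powR_dist_le p1 psg sg1 (aabs j Bf) (aabs j Bg)) _.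
rewrite ler_wpM2r ?powR_ge0// ler_wpM2l//.
exact: le_trans (ler_dist_dist _ _) (dist_ge _ _ _).
Qed.

Let size_bound := (Num.truncn (2 / (zeta * energy theta K))).+1.

Let size_cell (w : seq letter) f : cell (K:=K) eta B N a w f -> (size w < size_bound)%N.
Proof.
move=> wf; have wen := le_trans (cell_energy theta1 zeta0 Ba wf) (N1 (cell_sub wf)).
have ze : 0 < zeta * energy theta K by rewrite mulr_gt0// energy_gt0.
rewrite ltnS truncn_ge_nat ?divr_ge0 ?(ltW ze)// ler_pdivlMr//.
have : (size w)%:R * (zeta / 2 * energy theta K) <= 1.
  apply: le_trans wen; rewrite -sumr_seq_const.
  apply: ler_sum => l _; rewrite ler_wpM2l ?divr_ge0 ?(ltW zeta0)// energy_le ?(ltW th0)//.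
  by rewrite -ltnS.
lra.
Qed.

(** Pairs of words index the links of all chains at once.  The price [Lam] of a letter
    is the logarithm of twice the size of the alphabet, so that the union bound over
    all pairs converges. *)
Let links := [seq (w, w') | w <- words letter size_bound, w' <- words letter size_bound].
Let weight (c : seq letter * seq letter) : R :=
  1 + (Lam * (size c.1)%:R + Lam * (size c.2)%:R).

Let weight_ge1 c : 1 <= weight c.
Proof. by rewrite lerDl addr_ge0// mulr_ge0. Qed.

Let sum_weights : \sum_(c <- links) expR (- weight c) <= 2 * 2.
Proof.
have sW : \sum_(w <- words letter size_bound) expR (- (Lam * (size w)%:R)) <= 2.
  exact: sum_words.
have sW0 : 0 <= \sum_(w <- words letter size_bound) expR (- (Lam * (size w)%:R)).
  by apply: sumr_ge0 => w _; exact: expR_ge0.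
apply: le_trans (ler_pM sW0 sW0 sW sW).
rewrite big_allpairs big_distrlr/=; apply: ler_sum => w _; apply: ler_sum => w' _.
by rewrite -expRD ler_expR /weight/= -opprD lerN2 lerDr.
Qed.

Section chain.
Context (e : {ffun 'I_m -> bool}) (Q : R) (Q0 : 0 <= Q).
Context (QP : forall c, c \in links ->
  `|rademacher_sum e (fun j => h (cen c.1) j - h (cen c.2) j)| <=
  p * dist (cen c.1) (cen c.2) * D * weight c `^ sg * Q).

Let X g := rademacher_sum e (h g).

(** The factor [scale k] of the increment and the factor [weight ^ sg] of its price
    combine to [(energy k * weight) ^ sg], which [powR_le1D] makes linear in the energy. *)
Let link_bound k w w' : (size w < size_bound)%N -> (size w' < size_bound)%N ->
  (size w' <= size w)%N -> dist (cen w) (cen w') <= 6 * scale k ->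
  `|X (cen w) - X (cen w')| <=
  6 * p * D * Q * (2 + 2 * Lam * (energy theta k * (size w)%:R)).
Proof.
move=> wL w'L ww' dw; rewrite -rademacher_sumB.
apply: le_trans (QP (c := (w, w')) _) _ => /=.
  by apply: allpairs_f; apply: mem_words.
have nn : scale k * weight (w, w') `^ sg <= 2 + 2 * Lam * (energy theta k * (size w)%:R).
  have n0 : 0 <= weight (w, w') := le_trans ler01 (weight_ge1 _).
  have ek := energy_gt0 theta k.
  rewrite -(energy_root k theta1) -powRM ?(ltW ek)//.
  apply: le_trans (powR_le1D _ _) _; first by rewrite mulr_ge0// ltW.
    by rewrite (ltW sg0).
  rewrite /weight/=; have e1 := energy_le1 k (ltW th0).
  have : energy theta k * Lam * (size w')%:R <= energy theta k * Lam * (size w)%:R.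
    by rewrite ler_wpM2l ?mulr_ge0 ?(ltW ek)// ler_nat.
  move: e1; lra.
apply: le_trans (_ : p * (6 * scale k) * D * weight (w, w') `^ sg * Q <= _).
  by rewrite ler_wpM2r// ler_wpM2r ?powR_ge0// ler_wpM2r// ler_wpM2l.
have -> : p * (6 * scale k) * D * weight (w, w') `^ sg * Q =
   6 * p * D * Q * (scale k * weight (w, w') `^ sg) by ring.
by apply: ler_wpM2l nn; apply: mulr_ge0 => //; rewrite -mulrA !mulr_ge0.
Qed.

(** At the finest scale the trivial bound by [m] times the largest increment is
    enough. *)
Let tail_bound f w : B f -> m%:R * scale K <= 1 :> R ->
  (forall j, `|a f j - a (cen w) j| <= 2 * scale K) ->
  `|X f - X (cen w)| <= 2 * p * D.
Proof.
move=> Bf mK fw; rewrite -rademacher_sumB; apply: le_trans (ler_norm_rademacher_sum _ _) _.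
have sK : 0 <= scale K :> R by rewrite ltW// scale_gt0.
apply: le_trans (_ : \sum_(j < m) 2 * p * D * scale K <= _).
  apply: ler_sum => j _.
  apply: le_trans (power_increment j Bf (cenB _)) _.
  have -> : 2 * p * D * scale K = p * (2 * scale K) * D * 1 by ring.
  apply: ler_pM; rewrite ?mulr_ge0 ?powR_ge0//.
    rewrite ler_wpM2r// ler_wpM2l//; apply: dist_le => //.
    by rewrite mulr_ge0.
  apply: le_trans (_ : 1 `^ (1 - sg) <= _); last by rewrite powR1.
  apply: ge0_ler_powR; rewrite ?nnegrE ?subr_ge0//.
  apply: le_trans (t1 Bf (cenB w)).
  by rewrite (bigD1 j)//= lerDl sumr_ge0.
rewrite sumr_const card_ord -[leLHS]mulr_natl.
have -> : m%:R * (2 * p * D * scale K) = 2 * p * D * (m%:R * scale K) by ring.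
by apply: ler_piMr => //; rewrite -mulrA !mulr_ge0.
Qed.

(** The chain of [f] follows the centres of its nested words; only [Q] depends on the
    signs, and it is common to all [f]. *)
Lemma chaining f : B f ->
  `|X f| <= p * D * lam * (12 * (4 + 20 / zeta) * Q + 4).
Proof.
move=> Bf; have [lm mK Klm Llm] := log_parameters R m1; rewrite -/lam in lm Klm Llm.
have {Llm} Lam5 : Lam <= 5 * lam by rewrite /Lam card_letter.
have [W [W0 Wmon Wf Wnear We]] := nested_words theta1 zeta0 Ba Bf (leqnn K).
have sumE : \sum_(i < K.+1) energy theta i * (size (W i))%:R <= 4 / zeta.
  have := le_trans (cell_energy theta1 zeta0 Ba Wf) (N1 Bf); rewrite -mulr_sumr => en.
  have eWK : 0 <= energy theta K * (size (W K))%:R.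
    by rewrite mulr_ge0// ltW// energy_gt0.
  rewrite ler_pdivlMr//; move: We en eWK zeta0.
  set S1 := \sum_(i < _) _; set S2 := \sum_(l <- _) _; nra.
have Wle i k : (i + k <= K)%N -> (size (W i) <= size (W (i + k)))%N.
  elim: k => [|k IH]; first by rewrite addn0.
  by rewrite addnS => ik; apply: leq_trans (Wmon _ ik); apply: IH; exact: ltnW.
have WL i : (i <= K)%N -> (size (W i) < size_bound)%N.
  move=> iK; apply: leq_ltn_trans (size_cell Wf).
  by rewrite -{2}(subnKC iK) Wle// subnKC.
have -> : X f = (X f - X (cen (W K))) + \sum_(i < K) (X (cen (W i.+1)) - X (cen (W i))).
  (* The chain starts at the centre of the empty word, which is 0. *)
  have XW0 : X (cen (W 0)) = 0.
    have [[B0 _] a0 _ _] := Ba.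
    rewrite W0 /X /rademacher_sum big1// => j _.
    have -> : cen [::] = 0 by rewrite /cen /cell_center /near_min/=; case: asboolP.
    by rewrite /h a0 normr0 powR0 ?mulr0// gt_eqF// (lt_le_trans ltr01).
  rewrite -(big_mkord xpredT (fun i => X (cen (W i.+1)) - X (cen (W i)))).
  by rewrite telescope_sumr// XW0 subr0 subrK.
have step (i : 'I_K) : `|X (cen (W i.+1)) - X (cen (W i))| <=
    6 * p * D * Q * (2 + 2 * Lam * (energy theta i.+1 * (size (W i.+1))%:R)).
  have iK : (i < K)%N := ltn_ord i.
  apply: link_bound; [exact: WL|exact/WL/ltnW|exact: Wmon|].
  have s2 : scale i = 2 * scale i.+1 :> R by rewrite /scale exprS mulrA divff ?mul1r.
  apply: dist_le => [|j]; first by rewrite mulr_ge0// ltW// scale_gt0.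
  have near := lerD (Wnear _ j iK) (Wnear _ j (ltnW iK)).
  rewrite distrC in near; apply: le_trans (le_trans (ler_distD (a f j) _ _) near) _.
  by rewrite s2; lra.
apply: le_trans (ler_normD _ _) _.
apply: le_trans (lerD (tail_bound Bf mK (fun j => Wnear _ j (leqnn K))) (ler_norm_sum _ _ _)) _.
apply: le_trans (lerD (lexx _) (ler_sum _ (fun i _ => step i))) _.
rewrite -mulr_sumr big_split/= sumr_const card_ord -mulr_sumr -[2 *+ K]mulr_natl.
move: sumE; rewrite big_ord_recl /=; set S1 := energy _ _ * _; set S2 := \sum_(i < K) _.
move=> S12; have S10 : 0 <= S1 by rewrite mulr_ge0// ltW// energy_gt0.
have S2z : S2 <= 4 / zeta by apply: le_trans S12; rewrite lerDr.
have LS : Lam * S2 <= 5 * lam * (4 / zeta).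
  apply: le_trans (_ : Lam * (4 / zeta) <= _); first by rewrite ler_wpM2l.
  by rewrite ler_wpM2r// divr_ge0// ltW.
have -> : 2 * p * D + 6 * p * D * Q * (K%:R * 2 + 2 * Lam * S2) =
  p * D * (2 + 12 * (K%:R * Q) + 12 * (Lam * S2 * Q)) by ring.
rewrite -(mulrA (p * D)); apply: ler_wpM2l; first exact: mulr_ge0.
have KQ : K%:R * Q <= 4 * lam * Q by rewrite ler_wpM2r.
have LQ : Lam * S2 * Q <= 5 * lam * (4 / zeta) * Q by rewrite ler_wpM2r.
have -> : lam * (12 * (4 + 20 / zeta) * Q + 4) =
  4 * lam + 12 * (4 * lam * Q) + 12 * (5 * lam * (4 / zeta) * Q) by ring.
by move: KQ LQ lm; lra.
Qed.
End chain.

Lemma power_process_max (s : seq V) : (forall f, f \in s -> B f) ->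
  \sum_(e : {ffun 'I_m -> bool}) \big[Num.max/0]_(f <- s) `|rademacher_sum e (h f)|
  <= 2 ^+ m * (2 * p * (144 * (4 + 20 / zeta) + 4) * lam * r `^ (1 - sg)).
Proof.
move=> sB.
have [Q [QP Q0 Qsum]] := @rademacher_max_power R m _ links sg weight
   (fun c => p * dist (cen c.1) (cen c.2) * D)
   (fun c => t (cen c.1) (cen c.2))
   (fun c j => h (cen c.1) j - h (cen c.2) j)
   sg0 sg2 weight_ge1
   (fun c => mulr_ge0 (mulr_ge0 p0 (dist0 _ _)) D0)
   (fun c j => t0 _ _ _) (fun c => t1 (cenB _) (cenB _))
   (fun c j => power_increment j (cenB _) (cenB _)).
have {}Qsum : \sum_e Q e <= 2 ^+ m * 12.
  apply: le_trans Qsum _; rewrite ler_wpM2l ?exprn_ge0//.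
  by move: sum_weights; lra.
have lam0 : 0 <= lam by rewrite ln_ge0// ler1n ltnW.
set c := 4 + 20 / zeta.
have c0 : 0 <= c by rewrite addr_ge0 ?divr_ge0 ?ler0n// ltW.
have pDl : 0 <= p * D * lam by rewrite !mulr_ge0.
have max_bound e : \big[Num.max/0]_(f <- s) `|rademacher_sum e (h f)| <=
    p * D * lam * (12 * c * Q e + 4).
  apply: bigmaxr_le => [|f fs].
    by apply: mulr_ge0 => //; rewrite addr_ge0 ?mulr_ge0 ?ler0n.
  by apply: (chaining (Q0 e)) (sB f fs) => k; exact: QP.
apply: le_trans (ler_sum _ (fun e _ => max_bound e)) _.
rewrite -mulr_sumr big_split/= sum_signs_const -mulr_sumr.
have D2 : D <= 2 * r `^ (1 - sg).
  rewrite /D powRM ?(ltW r0)// ler_wpM2r ?powR_ge0//.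
  by apply: ler1_powR; rewrite ?ler1n// gerBl ltW.
apply: le_trans (_ : p * D * lam * (12 * c * (2 ^+ m * 12) + 2 ^+ m * 4) <= _).
  by rewrite ler_wpM2l// lerD2r ler_wpM2l// mulr_ge0 ?ler0n.
have -> : p * D * lam * (12 * c * (2 ^+ m * 12) + 2 ^+ m * 4) =
  D * (2 ^+ m * (p * (144 * c + 4) * lam)) by ring.
have -> : 2 ^+ m * (2 * p * (144 * c + 4) * lam * r `^ (1 - sg)) =
  2 * r `^ (1 - sg) * (2 ^+ m * (p * (144 * c + 4) * lam)) by ring.
rewrite ler_wpM2r// mulr_ge0 ?exprn_ge0// mulr_ge0// mulr_ge0//.
by rewrite addr_ge0 ?mulr_ge0 ?ler0n.
Qed.
End power_process.

Lemma rademacher_power_max (R : realType) (theta p zeta : R) :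
  2 <= theta -> theta <= p -> 0 < zeta ->
  exists2 C : R, 0 < C &
  forall (V : lmodType R) (m : nat) (B : set V) (N : V -> R) (a : V -> 'I_m -> R) (r : R),
  (1 < m)%N -> convex_sampling theta zeta B N a -> 0 < r ->
  (forall f, B f -> \sum_j `|a f j| `^ p <= r) ->
  forall s : seq V, (forall f, f \in s -> B f) ->
  \sum_(e : {ffun 'I_m -> bool})
    \big[Num.max/0]_(f <- s) `|rademacher_sum e (fun j => `|a f j| `^ p)|
  <= 2 ^+ m * (C * ln m%:R * r `^ (1 - theta^-1)).
Proof.
move=> theta2 thetap zeta0.
exists (2 * p * (144 * (4 + 20 / zeta) + 4)).
  have p0 : 0 < p by rewrite (lt_le_trans _ thetap)// (lt_le_trans _ theta2).
  rewrite !mulr_gt0// ltr_wpDl ?ltr0n// mulr_ge0 ?ler0n//.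
  by rewrite addr_ge0 ?divr_ge0 ?ler0n// ltW.
move=> V m B N a r m1 Ba r0 Br s sB.
exact: (power_process_max theta2 thetap zeta0 m1 Ba r0 Br sB).
Qed.

(** * Rescaling *)

Lemma powR_inv (R : realType) (x r : R) : 0 <= x -> x^-1 `^ r = (x `^ r)^-1.
Proof. by move=> x0; rewrite -powRN -powR_inv1// -powRrM mulN1r. Qed.

(** Weighted arithmetic-geometric mean with a free parameter [l]; the right-hand side
    is linear in [x] and [y], hence can be integrated term by term. *)
Lemma powR_young (R : realType) (x y l s : R) : 0 <= x -> 0 <= y -> 0 < l -> 0 < s <= 1 ->
  x `^ s * y `^ (1 - s) <= l `^ (s^-1 - 1) * x + y / l.
Proof.
move=> x0 y0 l0 /andP[s0 s1].
have amgm (a b : R) : 0 <= a -> 0 <= b -> a `^ s * b `^ (1 - s) <= a + b.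
  wlog : a b s s0 s1 / a <= b => [H a0 b0|ab a0 b0].
    have [/H->//|/ltW ba] := leP a b.
    have [s1'|s1'] := eqVneq s 1.
      by rewrite s1' subrr powRr0 mulr1 powRr1// lerDl.
    have := H b a (1 - s) _ _ ba b0 a0.
    by rewrite subKr mulrC (addrC b); apply; [rewrite subr_gt0 lt_neqAle s1'|rewrite gerBl ltW].
  apply: le_trans (_ : b `^ s * b `^ (1 - s) <= _).
    by rewrite ler_wpM2r ?powR_ge0//; apply: ge0_ler_powR; rewrite ?nnegrE// ltW.
  have [->|b1] := eqVneq b 0; first by rewrite powR0 ?gt_eqF// mul0r addr0.
  by rewrite -powRD ?b1 ?implybT// addrC subrK powRr1// lerDr.
apply: le_trans (amgm (l `^ (s^-1 - 1) * x) (y / l) _ _).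
- rewrite !powRM ?powR_ge0 ?invr_ge0 ?(ltW l0)// powR_inv ?(ltW l0)//.
  rewrite -powRrM mulrBl mulVf ?gt_eqF// mul1r.
  have -> : l `^ (1 - s) * x `^ s * (y `^ (1 - s) / l `^ (1 - s)) =
    x `^ s * y `^ (1 - s) * (l `^ (1 - s) / l `^ (1 - s)) by ring.
  by rewrite divff ?mulr1// gt_eqF// powR_gt0.
- by rewrite mulr_ge0 ?powR_ge0.
- by rewrite divr_ge0// ltW.
Qed.

(** Here the values [x f] are not normalized: [M] bounds them on the unit ball, and [r]
    bounds the sums of their [p]-th powers.  The free parameter [l] comes from
    [powR_young]. *)
Definition sampling_constant (R : realType) (theta p zeta C : R) : Prop :=
  forall (V : lmodType R) (m : nat) (B : set V) (N : V -> R) (x : V -> 'I_m -> R)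
    (M r l : R),
  (1 < m)%N -> B 0 -> N 0 = 0 -> (forall j, x 0 j = 0) ->
  (forall f, B f -> 0 <= N f <= 1) ->
  (forall f g, B f -> B g -> let h := 2^-1 *: (f + g) in
     [/\ B h, forall j, x h j = (x f j + x g j) / 2 &
       N h <= Num.max (N f) (N g) - zeta * N (f - g) `^ theta]) ->
  (forall f j, B f -> `|x f j| <= M) ->
  (forall f g j, B f -> B g -> `|x f j - x g j| <= M * N (f - g)) ->
  (forall f, B f -> \sum_j `|x f j| `^ p <= r) -> 0 < l ->
  forall s : seq V, (forall f, f \in s -> B f) ->
  \sum_(e : {ffun 'I_m -> bool})
    \big[Num.max/0]_(f <- s) `|rademacher_sum e (fun j => `|x f j| `^ p)|
  <= 2 ^+ m * (C * (l `^ (theta - 1) * (ln m%:R `^ theta * M `^ p) + r / l)).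

Lemma rademacher_sampling_bound (R : realType) (theta p zeta : R) :
  2 <= theta -> theta <= p -> 0 < zeta ->
  exists2 C : R, 0 < C & sampling_constant theta p zeta C.
Proof.
move=> theta2 thetap zeta0.
have [C C0 main] := rademacher_power_max theta2 thetap zeta0.
exists C => // V m B N x M r l m1 B0 N0 x0 N1 Bmid xM xN xr l0 s sB.
have th0 : 0 < theta by lra.
have p0 : p != 0 by rewrite gt_eqF//; lra.
have M0 : 0 <= M by apply: le_trans (xM 0 (Ordinal (ltnW m1)) B0).
have r0 : 0 <= r by apply: le_trans (xr 0 B0); apply: sumr_ge0 => j _; exact: powR_ge0.
have lm0 : 0 <= ln m%:R :> R by rewrite ln_ge0// ler1n ltnW.
(* If all values vanish there is nothing to prove; otherwise M and r are positive. *)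
have [triv|] := pselect (forall f j, B f -> `|x f j| `^ p = 0).
  rewrite big1.
    apply: mulr_ge0; first by rewrite exprn_ge0.
    apply: mulr_ge0; first exact: ltW.
    apply: addr_ge0; last by rewrite divr_ge0 ?(ltW l0).
    by rewrite !mulr_ge0 ?powR_ge0.
  move=> e _; rewrite big_seq; elim/big_ind: _ => // [a b -> ->|f fs]; first by rewrite maxxx.
  rewrite /rademacher_sum big1 ?normr0// => j _.
  by rewrite triv ?mulr0//; exact: sB.
move=> /existsNP[f1 /existsNP[j1 /not_implyP[Bf1 /eqP x1]]].
have x1p : 0 < `|x f1 j1| by rewrite normr_gt0; apply: contra_neq x1 => ->; rewrite normr0 powR0.
have Mp : 0 < M by apply: lt_le_trans (xM f1 j1 Bf1).
have rp : 0 < r.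
  apply: lt_le_trans (xr _ Bf1); rewrite (bigD1 j1)//=.
  by rewrite ltr_wpDr ?powR_gt0// sumr_ge0// => j _; exact: powR_ge0.
have MpM : 0 < M `^ p by rewrite powR_gt0.
pose a f j := x f j / M.
have aE f j : `|a f j| `^ p = `|x f j| `^ p / M `^ p.
  by rewrite /a normrM normfV (gtr0_norm Mp) powRM ?invr_ge0 ?(ltW Mp)// powR_inv ?(ltW Mp).
have Ba : convex_sampling theta zeta B N a.
  split=> //.
  - by move=> j; rewrite /a x0 mul0r.
  - move=> f Bf; split; first exact: N1.
    by move=> j; rewrite /a normrM normfV (gtr0_norm Mp) ler_pdivrMr// mul1r xM.
  move=> f g Bf Bg h; have [Bh xh Nh] := Bmid f g Bf Bg; split=> //.
    by move=> j; rewrite /a xh; field; rewrite gt_eqF.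
  move=> j; apply: le_trans Nh _; rewrite lerD2l lerN2 ler_wpM2l ?(ltW zeta0)//.
  have aN : `|a f j - a g j| <= N (f - g).
    by rewrite /a -mulrBl normrM normfV (gtr0_norm Mp) ler_pdivrMr// mulrC xN.
  by apply: ge0_ler_powR; rewrite ?nnegrE ?(ltW th0) ?(le_trans _ aN).
have ar f : B f -> \sum_j `|a f j| `^ p <= r / M `^ p.
  move=> Bf; under eq_bigr do rewrite aE.
  by rewrite -mulr_suml ler_pM2r ?invr_gt0// xr.
have H := main V m B N a (r / M `^ p) m1 Ba (divr_gt0 rp MpM) ar s sB.
have -> : \sum_(e : {ffun 'I_m -> bool})
    \big[Num.max/0]_(f <- s) `|rademacher_sum e (fun j => `|x f j| `^ p)| =
  M `^ p * \sum_(e : {ffun 'I_m -> bool})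
    \big[Num.max/0]_(f <- s) `|rademacher_sum e (fun j => `|a f j| `^ p)|.
  rewrite mulr_sumr; apply: eq_bigr => e _; rewrite -bigmaxrZ ?(ltW MpM)//.
  apply: eq_bigr => f _; rewrite -[X in X * _](gtr0_norm MpM) -normrM -rademacher_sumZ.
  by congr `|_|; apply: eq_bigr => j _; rewrite aE [M `^ p * _]mulrC divfK// gt_eqF.
apply: le_trans (ler_wpM2l (ltW MpM) H) _.
rewrite mulrCA ler_wpM2l ?exprn_ge0// -mulrA mulrCA ler_wpM2l ?(ltW C0)//.
have := @powR_young R (ln m%:R `^ theta * M `^ p) r l theta^-1 _ r0 l0 _.
rewrite invrK => Y; apply: le_trans (Y _ _); last 2 first.
- by rewrite mulr_ge0// powR_ge0.
- by rewrite invr_gt0 th0 invf_le1//; lra.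
have -> : (ln m%:R `^ theta * M `^ p) `^ theta^-1 = ln m%:R * (M `^ p) `^ theta^-1.
  by rewrite powRM ?powR_ge0// -powRrM divff ?gt_eqF// powRr1.
have -> : (r / M `^ p) `^ (1 - theta^-1) = r `^ (1 - theta^-1) / (M `^ p) `^ (1 - theta^-1).
  by rewrite powRM ?invr_ge0 ?(ltW MpM)// powR_inv// ltW.
set u := M `^ p in MpM *.
have -> : u `^ theta^-1 = u / u `^ (1 - theta^-1).
  rewrite -{2}(powRr1 (ltW MpM)) -powRB ?(gt_eqF MpM) ?implybT//.
  by rewrite opprB addrC subrK.
rewrite le_eqVlt; apply/orP; left; apply/eqP; ring.
Qed.

(** * Symmetrization *)

Section rectangles.
Context (I : finType) d (T : measurableType d).

(** Rectangles are stable under intersection and generate the product sigma-algebra of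
    the finite family, so that a law is determined by its values on them. *)
Definition rectangles : set (set (I -> T)) :=
  [set A | exists D : I -> set T, (forall i, measurable (D i)) /\
     A = [set x | forall i, D i (x i)]].

Local Notation cyl := (g_sigma_algebraType rectangles).

Lemma rectangles_setI : setI_closed rectangles.
Proof.
move=> _ _ [D [mD ->]] [D' [mD' ->]]; exists (fun i => D i `&` D' i); split.
  by move=> i; exact: measurableI.
by apply/seteqP; split=> x /= => [[xD xD'] i//|xDD']; split=> i; have [] := xDD' i.
Qed.

Lemma measurable_coordinate i : measurable_fun setT (fun x : cyl => x i).
Proof.
move=> _ A mA; rewrite setTI; apply: sub_sigma_algebra.
exists (fun j => if j == i then A else setT); split=> [j|]; first by case: ifP.
apply/seteqP; split=> x /=; last by move=> /(_ i); rewrite eqxx.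
by move=> xA j; case: eqP => [->|].
Qed.

Lemma measurable_to_rectangles d' (S : measurableType d') (phi : S -> I -> T) :
  (forall i, measurable_fun setT (phi ^~ i)) ->
  measurable_fun setT (phi : S -> cyl).
Proof.
move=> mphi; apply: (@measurability _ _ _ cyl setT phi rectangles) => // _ [_ [D [mD ->]] <-].
rewrite setTI.
have -> : phi @^-1` [set x | forall i, D i (x i)] =
    \bigcap_(i in [set: I]) ((phi ^~ i) @^-1` D i).
  by apply/seteqP; split=> x /= xD i; [move=> _|]; apply: xD.
by apply: fin_bigcap_measurable => // i _; rewrite -[X in measurable X]setTI; exact: mphi.
Qed.

Lemma integral_rectangles_unique (R : realType) d' (S : measurableType d')
    (mu : probability S R) (phi psi : S -> I -> T) (G : cyl -> \bar R) :
  (forall i, measurable_fun setT (phi ^~ i)) ->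
  (forall i, measurable_fun setT (psi ^~ i)) ->
  (forall A, rectangles A -> mu (phi @^-1` A) = mu (psi @^-1` A)) ->
  measurable_fun setT G -> (forall x, 0 <= G x)%E ->
  (\int[mu]_w G (phi w) = \int[mu]_w G (psi w))%E.
Proof.
move=> /measurable_to_rectangles mphi /measurable_to_rectangles mpsi eqR mG G0.
rewrite -[LHS](ge0_integral_pushforward mphi _ measurableT) => [|//|//].
rewrite -[RHS](ge0_integral_pushforward mpsi _ measurableT) => [|//|//].
apply: eq_measure_integral => A mA _.
apply: (@measure_unique _ R cyl rectangles (fun=> setT)) => //.
- exact: rectangles_setI.
- by move=> _; exists (fun=> setT); split => //; apply/seteqP; split.
- by apply/seteqP; split=> // x _; exists 0%N.
- by move=> k; rewrite /= /pushforward preimage_setT probability_setT ltry.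
Qed.
End rectangles.

Section symmetrization.
Context (R : realType) d (T : measurableType d) (P : probability T R)
  d' (T' : measurableType d') (m : nat) (X : 'I_m -> {RV P >-> T'}).
Hypothesis Xindep : mutually_independent X.

Let PP : probability (T * T)%type R := (P \x P)%E.

(** Two independent copies of the sample on [T * T], the two copies of the [j]-th point
    being exchanged when [e j] holds. *)
Definition two_samples (e : {ffun 'I_m -> bool}) (w : T * T) (i : 'I_m * bool) : T' :=
  X i.1 (if i.2 (+) e i.1 then w.2 else w.1).

Lemma measurable_two_samples e i : measurable_fun setT (two_samples e ^~ i).
Proof.
case: i => i b; rewrite /two_samples/=; case: (b (+) e i).
  exact: (measurableT_comp _ measurable_snd).
exact: (measurableT_comp _ measurable_fst).
Qed.

Lemma independent_rectangle (D : 'I_m -> set T') : (forall j, measurable (D j)) ->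
  P [set w | forall j, D j (X j w)] = (\prod_j P (X j @^-1` D j))%E.
Proof.
move=> mD; have := Xindep [set: 'I_m]%SET mD.
under eq_bigl do rewrite inE; move=> <-; congr (P _).
by apply/seteqP; split=> w /= h j; [move=> _|]; apply: h => //=; rewrite inE.
Qed.

(** Exchanging the two copies of some points preserves the joint law: both sides are
    the same product, in which only the order of two factors changes. *)
Lemma two_samples_rectangle e (A : set ('I_m * bool -> T')) :
  rectangles A -> PP (two_samples e @^-1` A) = PP (two_samples [ffun=> false] @^-1` A).
Proof.
move=> [D [mD ->]].
have mX j (C : set T') : measurable C -> measurable (X j @^-1` C).
  by move=> mC; rewrite -[X in measurable X]setTI; exact: measurable_funP.
have mPX (C : 'I_m -> set T') : (forall j, measurable (C j)) ->
    measurable [set w | forall j, C j (X j w)].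
  move=> mC; have -> : [set w | forall j, C j (X j w)] =
      \bigcap_(j in [set: 'I_m]) (X j @^-1` C j).
    by apply/seteqP; split=> w /= h j; [move=> _|]; apply: h.
  by apply: fin_bigcap_measurable => // j _; exact: mX.
have E e' : PP (two_samples e' @^-1` [set x | forall i, D i (x i)]) =
    (\prod_j (P (X j @^-1` D (j, e' j)) * P (X j @^-1` D (j, ~~ e' j))))%E.
  have -> : two_samples e' @^-1` [set x | forall i, D i (x i)] =
      [set w | forall j, D (j, e' j) (X j w)] `*`
      [set w | forall j, D (j, ~~ e' j) (X j w)].
    apply/seteqP; split=> [[w w'] /= h|[w w'] /= [h h'] [j b]].
      by split=> j; [have := h (j, e' j)|have := h (j, ~~ e' j)];
        rewrite /two_samples/=; case: (e' j).
    by rewrite /two_samples/=; have := h j; have := h' j; case: (e' j) b => -[].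
  transitivity (P [set w | forall j, D (j, e' j) (X j w)] *
      P [set w | forall j, D (j, ~~ e' j) (X j w)])%E.
    by apply: (product_measure1E P P);
      [apply: (mPX (fun j => D (j, e' j)))|apply: (mPX (fun j => D (j, ~~ e' j)))].
  rewrite (independent_rectangle (fun j => mD (j, e' j))).
  by rewrite (independent_rectangle (fun j => mD (j, ~~ e' j))) -big_split.
rewrite !E; apply: eq_bigr => j _; rewrite ffunE/=.
by case: (e j) => //=; rewrite muleC.
Qed.

Context (I : eqType) (h : I -> T' -> R) (c : I -> R) (s : seq I) (m0 : (0 < m)%N).
Hypothesis mh : forall i, i \in s -> measurable_fun setT (h i).
Hypothesis hX : forall i j, i \in s -> P.-integrable setT (EFin \o (h i \o X j)).
Hypothesis hc : forall i j, i \in s -> (\int[P]_w (h i (X j w))%:E = (c i)%:E)%E.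

Let gap (x : 'I_m * bool -> T') : R :=
  \big[Num.max/0]_(i <- s) `|m%:R^-1 * \sum_j (h i (x (j, false)) - h i (x (j, true)))|.

Let measurable_gap : measurable_fun setT
  (gap : g_sigma_algebraType (@rectangles ('I_m * bool)%type d' T') -> R).
Proof.
apply: measurable_bigmax => i si; apply: measurableT_comp => //.
apply: measurable_funM => //; apply: measurable_sum => j.
apply: measurable_funB; apply: (measurableT_comp (mh si)); exact: measurable_coordinate.
Qed.

Let measurable_gap_two e : measurable_fun setT (fun w => (gap (two_samples e w))%:E).
Proof.
apply/measurable_EFinP; apply: (measurableT_comp measurable_gap).
by apply: measurable_to_rectangles => i; exact: measurable_two_samples.
Qed.

Let gapE e w : gap (two_samples e w) = \big[Num.max/0]_(i <- s)
  `|m%:R^-1 * \sum_j (-1) ^+ e j * (h i (X j w.1) - h i (X j w.2))|.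
Proof.
apply: eq_bigr => i _; congr `|_ * _|; apply: eq_bigr => j _; rewrite /two_samples/=.
by case: (e j) => /=; rewrite ?expr1 ?expr0 ?mul1r ?mulN1r ?opprB.
Qed.

(** Jensen's inequality: the mean is the average over the second copy. *)
Lemma deviation_le_gap w :
  ((\big[Num.max/0]_(i <- s) `|m%:R^-1 * \sum_j h i (X j w) - c i|)%:E <=
   \int[P]_w' (gap (two_samples [ffun=> false] (w, w')))%:E)%E.
Proof.
set J := (\int[P]_w' _)%E.
have mgap : measurable_fun setT (fun w' => (gap (two_samples [ffun=> false] (w, w')))%:E).
  exact: measurableT_comp (measurable_gap_two _) (measurable_pair1 w).
have mm : m%:R != 0 :> R by rewrite pnatr_eq0 -lt0n.
have H i : i \in s -> ((`|m%:R^-1 * \sum_j h i (X j w) - c i|)%:E <= J)%E.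
  move=> si.
  pose Z j w' := (m%:R^-1 * (h i (X j w) - h i (X j w')))%:E.
  have iZ j : P.-integrable setT (Z j).
    rewrite /Z; under eq_fun do rewrite EFinM; apply: integrableZl => //.
    under eq_fun do rewrite EFinB; apply: integrableB => //; last exact: (hX _ si).
    exact: finite_measure_integrable_cst.
  have ZE : (\int[P]_w' \sum_j Z j w' = (m%:R^-1 * \sum_j h i (X j w) - c i)%:E)%E.
    rewrite integral_sum//.
    have -> : (m%:R^-1 * \sum_j h i (X j w) - c i) =
        \sum_j m%:R^-1 * (h i (X j w) - c i).
      rewrite -mulr_sumr sumrB mulrBr sumr_const card_ord -[c i *+ m]mulr_natl.
      by rewrite mulrA mulVf// mul1r.
    rewrite -sumEFin; apply: eq_bigr => j _; rewrite /Z.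
    under eq_integral do rewrite EFinM; rewrite integralZl//; last first.
      under eq_fun do rewrite EFinB; apply: integrableB => //; last exact: (hX _ si).
      exact: finite_measure_integrable_cst.
    under eq_integral do rewrite EFinB.
    rewrite integralB_EFin//; [|exact: finite_measure_integrable_cst|exact: (hX _ si)].
    by rewrite (hc _ si) integral_cst//= probability_setT mule1.
  rewrite -abse_EFin -ZE; apply: le_trans (le_abse_integral _ measurableT _) _.
    by apply: emeasurable_sum => j; apply: measurable_int (iZ j).
  apply: ge0_le_integral => //.
    by apply: measurableT_comp => //; apply: emeasurable_sum => j; apply: measurable_int (iZ j).
  move=> w' _; rewrite /Z sumEFin abse_EFin lee_fin -mulr_sumr.
  rewrite gapE/=; under [leRHS]eq_bigr do under eq_bigr do rewrite ffunE mul1r.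
  exact: (le_bigmaxr (fun i => `|m%:R^-1 * \sum_j (h i (X j w) - h i (X j w'))|) si).
have J0 : (0 <= J)%E by apply: integral_ge0 => w' _; rewrite lee_fin bigmaxr_ge0.
have [->|Jfin] := eqVneq J +oo%E; first exact: leey.
have {}Jfin : J \is a fin_num by rewrite ge0_fin_numE// ltey.
rewrite -(fineK Jfin) lee_fin; apply: bigmaxr_le; first exact: fine_ge0.
by move=> i /H; rewrite -(fineK Jfin) lee_fin.
Qed.

(** The inequality holds for each fixed pattern of signs, because exchanging the two
    copies of the [j]-th point changes the sign of the [j]-th difference; it can then
    be averaged over the patterns. *)
Lemma symmetrization e :
  (\int[P]_w (\big[Num.max/0]_(i <- s) `|m%:R^-1 * \sum_j h i (X j w) - c i|)%:E <=
   2%:E * \int[P]_w (\big[Num.max/0]_(i <- s)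
     `|m%:R^-1 * rademacher_sum e (fun j => h i (X j w))|)%:E)%E.
Proof.
set H := fun w => (\big[Num.max/0]_(i <- s)
     `|m%:R^-1 * rademacher_sum e (fun j => h i (X j w))|)%:E.
have mhX i j : i \in s -> measurable_fun setT (fun w => h i (X j w)).
  by move=> si; exact: (measurableT_comp (mh si)).
have mH : measurable_fun setT H.
  apply/measurable_EFinP; apply: measurable_bigmax => i si; apply: measurableT_comp => //.
  apply: measurable_funM => //; apply: measurable_sum => j.
  by apply: measurable_funM => //; exact: mhX.
have H0 w : (0 <= H w)%E by rewrite lee_fin bigmaxr_ge0.
have gap0 e' w : (0 <= (gap (two_samples e' w))%:E)%E by rewrite lee_fin bigmaxr_ge0.
apply: (@le_trans _ _ (\int[P]_w \int[P]_w' (gap (two_samples [ffun=> false] (w, w')))%:E)%E).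
  apply: ge0_le_integral => //.
  - by move=> w _; rewrite lee_fin bigmaxr_ge0.
  - apply/measurable_EFinP; apply: measurable_bigmax => i si; apply: measurableT_comp => //.
    apply: measurable_funB => //; apply: measurable_funM => //.
    by apply: measurable_sum => j; exact: mhX.
  - exact: (measurable_fun_fubini_tonelli_F _ (measurable_gap_two _) (gap0 _)).
  - by move=> w _; exact: deviation_le_gap.
have -> : (\int[P]_w \int[P]_w' (gap (two_samples [ffun=> false] (w, w')))%:E =
    \int[P]_w \int[P]_w' (gap (two_samples e (w, w')))%:E)%E.
  have E e' := @fubini_tonelli1 _ _ _ _ _ P P _ (measurable_gap_two e') (gap0 e').
  rewrite -[LHS]E -[RHS]E.
  apply: (integral_rectangles_unique (mu := PP) (G := fun x => (gap x)%:E)) => //.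
  - exact: measurable_two_samples.
  - exact: measurable_two_samples.
  - by move=> A rA; rewrite [RHS]two_samples_rectangle// two_samples_rectangle.
  - exact/measurable_EFinP.
  - by move=> x; rewrite lee_fin bigmaxr_ge0.
apply: (@le_trans _ _ (\int[P]_w \int[P]_w' (H w + H w'))%E).
  apply: ge0_le_integral => //.
  - by move=> w _; apply: integral_ge0.
  - exact: (measurable_fun_fubini_tonelli_F _ (measurable_gap_two _) (gap0 _)).
  - under eq_fun do rewrite ge0_integralD//.
    apply: emeasurable_funD; last exact: measurable_cst.
    under eq_fun do rewrite integral_cst//=.
    exact: emeasurable_funM.
  move=> w _; apply: ge0_le_integral => //.
  - exact: measurableT_comp (measurable_gap_two _) (measurable_pair1 w).
  - by apply: emeasurable_funD.
  move=> w' _; rewrite gapE /H -EFinD lee_fin; apply: bigmaxr_le.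
    by rewrite addr_ge0// bigmaxr_ge0.
  move=> i si /=; under eq_bigr do rewrite mulrBr; rewrite sumrB mulrBr.
  apply: le_trans (ler_normB _ _) _; apply: lerD.
    exact: (le_bigmaxr (fun i => `|m%:R^-1 * rademacher_sum e (fun j => h i (X j w))|) si).
  exact: (le_bigmaxr (fun i => `|m%:R^-1 * rademacher_sum e (fun j => h i (X j w'))|) si).
have -> : (\int[P]_w \int[P]_w' (H w + H w') = \int[P]_w (H w + \int[P]_w' H w'))%E.
  apply: eq_integral => w _; rewrite ge0_integralD//; congr (_ + _)%E.
  by rewrite integral_cst//= probability_setT mule1.
rewrite ge0_integralD//; last by move=> w _; apply: integral_ge0.
by rewrite integral_cst//= probability_setT mule1 mule_natl mule2n.
Qed.
End symmetrization.

(** * Rational balls and the self-bounding inequality *)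

(** Rational combinations form a countable set, on which suprema of measurable
    functions are measurable, and still contain enough midpoints and multiples. *)
Definition ratspan (R : realType) (V : lmodType R) (s : seq V) : set V :=
  range (fun q : {ffun 'I_(size s) -> rat} => \sum_i ratr (q i) *: s`_i).

Section ratspan.
Context (R : realType) (V : lmodType R) (s : seq V).

Lemma ratspan_gen f : f \in s -> ratspan s f.
Proof.
move=> fs; have k : (index f s < size s)%N by rewrite index_mem.
exists [ffun i => (i == Ordinal k)%:R] => //.
rewrite (bigD1 (Ordinal k))//= ffunE eqxx rmorph1 scale1r nth_index// big1 ?addr0//.
by move=> i /negbTE ik; rewrite ffunE ik rmorph0 scale0r.
Qed.

Lemma ratspan0 : ratspan s 0.
Proof.
exists [ffun=> 0] => //; rewrite big1// => i _.
by rewrite ffunE rmorph0 scale0r.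
Qed.

Lemma ratspanD f g : ratspan s f -> ratspan s g -> ratspan s (f + g).
Proof.
move=> [q _ <-] [q' _ <-]; exists [ffun i => q i + q' i] => //.
by rewrite -big_split/=; apply: eq_bigr => i _; rewrite ffunE rmorphD scalerDl.
Qed.

Lemma ratspanZ (c : rat) f : ratspan s f -> ratspan s (ratr c *: f).
Proof.
move=> [q _ <-]; exists [ffun i => c * q i] => //.
by rewrite scaler_sumr; apply: eq_bigr => i _; rewrite ffunE rmorphM scalerA.
Qed.

Lemma ratspanB f g : ratspan s f -> ratspan s g -> ratspan s (f - g).
Proof.
move=> sf sg; apply: ratspanD => //.
by have := ratspanZ (-1) sg; rewrite rmorphN1 scaleN1r.
Qed.

Lemma ratspan_sub (L : set V) : linear_subspace L -> (forall f, f \in s -> L f) ->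
  ratspan s `<=` L.
Proof.
move=> [L0 LD] sL _ [q _ <-].
have {}L0 : L 0 by have := L0; rewrite inE.
have {}LD a f g : L f -> L g -> L (a *: f + g).
  by move=> Lf Lg; have := LD a f g; rewrite !inE; apply.
elim/big_rec: _ => // i f _ Lf; apply: LD => //.
by apply: sL; rewrite mem_nth.
Qed.

Lemma ratspan_enum : exists u : nat -> V, ratspan s = range u.
Proof.
exists (fun n => if unpickle n is Some q
  then \sum_(i < size s) ratr ((q : {ffun 'I_(size s) -> rat}) i) *: s`_i else 0).
apply/seteqP; split=> [_ [q _ <-]|_ [n _ <-]].
  by exists (pickle q) => //; rewrite pickleK.
case: (unpickle n) => [q|]; last exact: ratspan0.
by exists q.
Qed.

End ratspan.

Section norm.
Context (R : realType) (V : lmodType R) (L : set V) (N : V -> R).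
Context (hL : linear_subspace L) (hN : norm_on L N).

Let L0 : L 0. Proof. by have [] := hL; rewrite inE. Qed.
Let LD a f g : L f -> L g -> L (a *: f + g).
Proof. by move=> Lf Lg; have [_ /(_ a f g)] := hL; rewrite !inE; apply. Qed.

Lemma norm_on0 : N 0 = 0.
Proof. by have [_ _ /(_ 0 _ L0)] := hN; rewrite scale0r normr0 mul0r. Qed.

Definition ratball (s : seq V) : set V := ratspan s `&` [set f | N f <= 1].

Context (s : seq V) (sL : forall f, f \in s -> L f).

Let spanL : ratspan s `<=` L. Proof. exact: ratspan_sub. Qed.

Lemma ratball_sub : ratball s `<=` [set f | L f /\ N f <= 1].
Proof. by move=> f [/spanL]. Qed.

Lemma ratball_enum : exists u : nat -> V, ratball s = range u.
Proof.
have [u us] := ratspan_enum s.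
exists (fun n => if N (u n) <= 1 then u n else 0).
have b0 : ratball s 0 by split; [exact: ratspan0|rewrite /= norm_on0].
apply/seteqP; split=> [f []|_ [n _ <-]].
  by rewrite us => -[n _ <-] /= N1; exists n => //; rewrite N1.
by case: ifPn => // N1; split=> //; rewrite us; exists n.
Qed.

Lemma ratball_mid f g : ratball s f -> ratball s g -> ratball s (2^-1 *: (f + g)).
Proof.
move=> [sf Nf] [sg Ng]; split.
  have := ratspanZ (2^-1) (ratspanD sf sg).
  by rewrite fmorphV rmorph_nat.
have Lfg : L (f + g) by have := LD 1 (spanL sf) (spanL sg); rewrite scale1r.
have [_ _ NZ NT] := hN; rewrite /= NZ//.
have := NT _ _ (spanL sf) (spanL sg).
by move: Nf Ng => /= Nf Ng; rewrite ger0_norm ?invr_ge0//; lra.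
Qed.

(** Homogeneity up to rational factors: dividing [f - g] by a rational number slightly
    larger than [N (f - g)] gives an element of the ball. *)
Lemma ratball_lipschitz (phi : V -> R) (M : R) :
  (forall a f, phi (a *: f) = a * phi f) -> (forall f g, phi (f - g) = phi f - phi g) ->
  (forall f, ratball s f -> `|phi f| <= M) ->
  forall f g, ratball s f -> ratball s g -> `|phi f - phi g| <= M * N (f - g).
Proof.
move=> phiZ phiB phiM f g [sf _] [sg _]; rewrite -phiB.
have sh := ratspanB sf sg; set h := f - g in sh *.
have Lh := spanL sh.
have [N0 _ NZ _] := hN.
have Nh0 := N0 _ Lh.
have H (q : rat) : N h < ratr q -> `|phi h| <= M * ratr q.
  move=> hq; have q0 : 0 < ratr q :> R by exact: le_lt_trans hq.
  have /phiM : ratball s (ratr q^-1 *: h).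
    split; first exact: ratspanZ.
    by rewrite /= NZ// fmorphV normfV (gtr0_norm q0) mulrC ler_pdivrMr// mul1r ltW.
  by rewrite phiZ fmorphV normrM normfV (gtr0_norm q0) mulrC ler_pdivrMr.
have M0 : 0 <= M.
  apply: le_trans (phiM 0 _); first exact: normr_ge0.
  by split; [exact: ratspan0|rewrite /= norm_on0].
rewrite leNgt; apply/negP => hM.
have [M00|Mn0] := eqVneq M 0.
  have [q] := @rat_in_itvoo R (N h) (N h + 1) ltac:(by rewrite ltrDl).
  rewrite in_itv/= => /andP[/H]; rewrite M00 mul0r.
  by move: hM; rewrite M00 mul0r => /lt_le_trans/[apply]; rewrite ltxx.
have Mp : 0 < M by rewrite lt_neqAle eq_sym Mn0.
have [q] := @rat_in_itvoo R (N h) (`|phi h| / M) ltac:(by rewrite ltr_pdivlMr// mulrC).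
rewrite in_itv/= => /andP[/H le]; rewrite ltr_pdivlMr// mulrC => /(le_lt_trans le).
by rewrite ltxx.
Qed.
End norm.

(** The parameter [l] is the larger of [2 * K], which allows half of [D] to be absorbed
    by the left-hand side, and [(S / a)^(1 / theta)], which balances the two remaining
    terms. *)
Lemma self_bound (R : realType) (theta K a S D : R) :
  2 <= theta -> 0 < K -> 0 <= a -> 0 <= S -> 0 <= D -> (a = 0 -> S = 0) ->
  (forall l, 0 < l -> D <= K * (l `^ (theta - 1) * a + (D + S) / l)) ->
  D <= 2 * K * ((2 * K) `^ (theta - 1) + 2) *
    (a + a `^ theta^-1 * S `^ (1 - theta^-1)).
Proof.
move=> theta2 K0 a0 S0 D0 aS H.
have th0 : 0 < theta by lra.
have K20 : 0 < 2 * K by rewrite mulr_gt0.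
have half l : 2 * K <= l -> D <= 2 * K * (l `^ (theta - 1) * a + S / l).
  move=> Kl; have l0 : 0 < l by exact: lt_le_trans Kl.
  have := H l l0; rewrite mulrDl.
  have : K * (D / l) <= D / 2.
    rewrite mulrCA ler_wpM2l// -[leLHS]/(K / l) ler_pdivrMr//; lra.
  lra.
have [az|an] := eqVneq a 0.
  have := half _ (lexx _); rewrite (aS az) az mulr0 mul0r addr0 mulr0 => Dz.
  apply: le_trans Dz _; apply: mulr_ge0.
    by rewrite mulr_ge0 ?(ltW K20)// addr_ge0 ?powR_ge0.
  by rewrite add0r mulr_ge0 ?powR_ge0.
have ap : 0 < a by rewrite lt_neqAle eq_sym an.
set x := (S / a) `^ theta^-1.
have x0 : 0 <= x by exact: powR_ge0.
set y := a `^ theta^-1 * S `^ (1 - theta^-1).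
have y0 : 0 <= y by rewrite mulr_ge0 ?powR_ge0.
have c0 : 0 <= (2 * K) `^ (theta - 1) by exact: powR_ge0.
have ax : a * x `^ (theta - 1) = y.
  rewrite /x -powRrM mulrBr mulVf ?gt_eqF// mulr1.
  rewrite powRM ?invr_ge0// powR_inv// mulrCA /y mulrC; congr (_ * _).
  rewrite -{1}(powRr1 a0) -powRB ?an ?implybT//.
  by rewrite opprB addrC subrK.
have Sx l : x <= l -> 0 < l -> S / l <= y.
  move=> xl l0; have [->|Sn] := eqVneq S 0; first by rewrite mul0r.
  have Sp : 0 < S by rewrite lt_neqAle eq_sym Sn.
  have xp : 0 < x by rewrite powR_gt0// divr_gt0.
  apply: le_trans (_ : S / x <= _); first by rewrite ler_wpM2l// lef_pV2.
  rewrite /x powRM ?invr_ge0// powR_inv// invf_div mulrCA /y ler_wpM2l ?powR_ge0//.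
  rewrite -[leLHS]/(S / _) powRB ?Sn ?implybT// powRr1//.
apply: le_trans (half (Num.max (2 * K) x) _) _; first by rewrite le_max lexx.
set l := Num.max _ _.
have l0 : 0 < l by rewrite lt_max K20.
have lx : S / l <= y by apply: Sx => //; rewrite le_max lexx orbT.
have la : l `^ (theta - 1) * a <= (2 * K) `^ (theta - 1) * a + y.
  rewrite /l /Num.max; case: ifPn => _; last by rewrite lerDl.
  by rewrite mulrC ax lerDr mulr_ge0.
rewrite -(mulrA (2 * K) _ (a + y)) ler_wpM2l ?(ltW K20)//.
have : 0 <= (2 * K) `^ (theta - 1) * y by rewrite mulr_ge0.
nra.
Qed.

(** * Expected deviation *)

Lemma continuous_borel (R : realType) (Om : ptopologicalType) (f : Om -> R) :
  continuous f -> measurable_fun setT (f : borel Om -> R).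
Proof.
move=> /continuousP cf; apply: (measurability _ (RGenOpens.measurableE R)) => //.
move=> _ [_ [a [b ->]] <-]; rewrite setTI; apply: sub_sigma_algebra.
by apply: cf; exact: interval_open.
Qed.

Lemma Lnorm_powR (R : realType) d (T : measurableType d) (mu : {measure set T -> \bar R})
    (p : R) (f : T -> R) : 0 < p -> finite_norm mu p%:E f ->
  (\int[mu]_x (`|f x| `^ p)%:E = (fine 'N[mu]_p%:E[EFin \o f] `^ p)%:E)%E.
Proof.
move=> p0; rewrite /finite_norm unlock.
have -> : (\int[mu]_x `|(EFin \o f) x| `^ p = \int[mu]_x (`|f x| `^ p)%:E)%E.
  by apply: eq_integral => x _; rewrite -poweR_EFin.
have : (0 <= \int[mu]_x (`|f x| `^ p)%:E)%E.
  by apply: integral_ge0 => x _; rewrite lee_fin powR_ge0.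
have pi : p^-1 != 0 by rewrite invr_eq0 gt_eqF.
case: (\int[mu]_x _)%E => [r|_|//]; last by rewrite poweRyr // ltxx.
rewrite lee_fin poweR_EFin => r0 _ /=.
by rewrite -powRrM mulVf ?gt_eqF// powRr1.
Qed.

Lemma ereal_sup_bigmax (R : realType) (V : eqType) (s : seq V) (f0 : V) (g : V -> R) :
  f0 \in s -> (forall f, 0 <= g f) ->
  ereal_sup [set (g f)%:E | f in [set` s]] = (\big[Num.max/0]_(f <- s) g f)%:E.
Proof.
move=> sf0 g0; apply/eqP; rewrite eq_le; apply/andP; split.
  apply: ge_ereal_sup => _ [f /= fs <-]; rewrite lee_fin.
  exact: (le_bigmaxr g fs).
rewrite big_seq; elim/big_ind: _ => [|x y xs ys|f fs].
- by apply: le_ereal_sup_tmp; exists (g f0)%:E; [exists f0|rewrite lee_fin].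
- by rewrite EFin_max ge_max xs ys.
- by apply: ereal_sup_ubound; exists f.
Qed.

Lemma Esup_mono (R : realType) d (T : measurableType d) (P : probability T R)
    (I : Type) (B B' : set I) (Z : I -> T -> R) :
  B `<=` B' -> (Esup P B Z <= Esup P B' Z)%E.
Proof.
move=> BB'; apply: ge_ereal_sup => _ [F [finF FB] <-].
by apply: ereal_sup_ubound; exists F => //; split => //; exact: subset_trans FB BB'.
Qed.

Section sampled_class.
Context (R : realType) (theta p zeta : R).
Context (htheta : 2 <= theta) (hp : theta <= p).
Context (Om : ptopologicalType) (mu : probability (borel Om) R) (L : set (Om -> R^o)).
Context (hL : linear_subspace L)
  (hLC : forall f : Om -> R, L f -> continuous f)
  (hLp : forall f : borel Om -> R, L f -> finite_norm mu p%:E f).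
Context (N : (Om -> R^o) -> R) (hN : norm_on L N) (hNc : theta_convex_norm L N theta zeta).
Context (m : nat) (hm : (1 < m)%N) (d : measure_display) (T : measurableType d)
  (P : probability T R) (X : 'I_m -> {RV P >-> borel Om}).
Context (Xindep : mutually_independent X)
  (Xlaw : forall j D, measurable D -> distribution P (X j) D = mu D).

Let B : set (Om -> R^o) := [set f | L f /\ N f <= 1].
Let mean (f : Om -> R) : R := fine 'N[mu]_p%:E[EFin \o f]%E `^ p.
Let dev (f : Om -> R) (w : T) : R :=
  `| m%:R^-1 * \sum_(j < m) `|f (X j w)| `^ p - mean f |.
Let peak (f : Om -> R) (w : T) : R :=
  \big[Num.max/0]_(j < m) (`|f (X j w)| `^ p).

Let p0 : 0 < p. Proof. by move: htheta hp => h1 h2; lra. Qed.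
Let m0 : (0 < m)%N. Proof. exact: ltnW. Qed.
Let m0R : 0 < m%:R :> R. Proof. by rewrite ltr0n. Qed.

Let mpow f : L f -> measurable_fun setT (fun x : borel Om => `|f x| `^ p).
Proof.
move=> /hLC/continuous_borel mf.
by apply: (measurableT_comp (measurable_powR p)); apply: measurableT_comp mf.
Qed.

Let mpowX f j : L f -> measurable_fun setT (fun w => `|f (X j w)| `^ p).
Proof. by move=> Lf; exact: (measurableT_comp (mpow Lf)). Qed.

Lemma mean_sample f j : L f -> (\int[P]_w (`|f (X j w)| `^ p)%:E = (mean f)%:E)%E.
Proof.
move=> Lf; rewrite /mean -(Lnorm_powR p0 (hLp Lf)).
have mf : measurable_fun setT (fun x : borel Om => (`|f x| `^ p)%:E).
  by apply/measurable_EFinP; exact: mpow.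
rewrite -[LHS](ge0_integral_distribution (X j) mf) => [|x]; last by rewrite lee_fin powR_ge0.
by apply: eq_measure_integral => A mA _; exact: Xlaw.
Qed.

Let integrable_sample f j : L f -> P.-integrable setT (EFin \o (fun w => `|f (X j w)| `^ p)).
Proof.
move=> Lf; apply/integrableP; split; first by apply/measurable_EFinP; exact: mpowX.
have -> : (\int[P]_w `|(EFin \o (fun w => (`|f (X j w)| `^ p)%R)) w| =
    \int[P]_w (`|f (X j w)| `^ p)%:E)%E.
  by apply: eq_integral => w _; rewrite gee0_abs// lee_fin powR_ge0.
by rewrite mean_sample// ltry.
Qed.

Let mean0 f : 0 <= mean f. Proof. exact: powR_ge0. Qed.
Let dev0 f w : 0 <= dev f w. Proof. exact: normr_ge0. Qed.
Let peak0 f w : 0 <= peak f w. Proof. exact: bigmaxr_ge0. Qed.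

Let mdev f : L f -> measurable_fun setT (dev f).
Proof.
move=> Lf; apply: measurableT_comp => //; apply: measurable_funB => //.
by apply: measurable_funM => //; apply: measurable_sum => j; exact: mpowX.
Qed.

Let mpeak f : L f -> measurable_fun setT (peak f).
Proof. by move=> Lf; apply: measurable_bigmax => j _; exact: mpowX. Qed.

Let peak_ge f w j : `|f (X j w)| `^ p <= peak f w.
Proof.
have jm : j \in index_enum 'I_m by rewrite mem_index_enum.
exact: (le_bigmaxr (fun j => `|f (X j w)| `^ p) jm).
Qed.

Let sum_le_peak f w : m%:R^-1 * \sum_(j < m) `|f (X j w)| `^ p <= peak f w.
Proof.
rewrite mulrC ler_pdivrMr//; apply: le_trans (_ : \sum_(j < m) peak f w <= _).
  by apply: ler_sum => j _; exact: peak_ge.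
by rewrite sumr_const card_ord mulr_natr.
Qed.

(** The mean of one function is dominated by the expected peak, so the means are bounded
    as soon as the peak is integrable, and vanish with it. *)
Lemma mean_le_Esup_peak f : B f -> ((mean f)%:E <= Esup P B peak)%E.
Proof.
move=> Bf; have Lf := Bf.1; rewrite -(mean_sample (Ordinal m0) Lf).
apply: (@le_trans _ _ (\int[P]_w ereal_sup [set (peak g w)%:E | g in [set f]])%E).
  apply: ge0_le_integral => //.
  - by apply/measurable_EFinP; exact: mpowX.
  - under eq_fun do rewrite image_set1 ereal_sup1.
    by apply/measurable_EFinP; exact: mpeak.
  - by move=> w _; rewrite image_set1 ereal_sup1 lee_fin; exact: peak_ge.
by apply: ereal_sup_ubound; exists [set f] => //; split; [exact: finite_set1|move=> _ ->].
Qed.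

Context (s : seq (Om -> R^o)) (sB : forall f, f \in s -> B f).
Let D := ratball N s.
Let sL f : f \in s -> L f. Proof. by move=> /sB[]. Qed.
Let DB : D `<=` B. Proof. exact: ratball_sub. Qed.
Let DL f : D f -> L f. Proof. by move=> /DB[]. Qed.

Let peakD w : \bar R := ereal_sup [set (peak f w)%:E | f in D].
Let devD w : \bar R := ereal_sup [set (dev f w)%:E | f in D].

Let D0 : D 0. Proof. by split; [exact: ratspan0|rewrite /= (norm_on0 hL hN)]. Qed.

Let EsupD (Z : (Om -> R) -> T -> R) :
  (forall f, L f -> measurable_fun setT (Z f)) -> (forall f w, 0 <= Z f w) ->
  measurable_fun setT (fun w => ereal_sup [set (Z f w)%:E | f in D]) /\
  (Esup P D Z = \int[P]_w ereal_sup [set (Z f w)%:E | f in D])%E.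
Proof.
move=> mZ Z0; have [u Du] := ratball_enum hL hN s; rewrite -/D in Du.
have Lu n : L (u n) by apply: DL; rewrite Du; exists n.
split; first by rewrite Du; apply: range_measurable_sup => n; exact: mZ.
apply: (@Esup_integral_seq _ _ _ _ _ _ _ u) => //.
- by move=> n; rewrite Du; exists n.
- by move=> f /DL; exact: mZ.
- by move=> f w Df; apply: ereal_sup_ubound; exists f => //; rewrite -Du.
Qed.

Let mpeakD : measurable_fun setT peakD. Proof. by have [] := EsupD mpeak peak0. Qed.
Let mdevD : measurable_fun setT devD. Proof. by have [] := EsupD mdev dev0. Qed.

Let peakD0 w : (0 <= peakD w)%E.
Proof.
by apply: le_ereal_sup_tmp; exists (peak 0 w)%:E; [exists 0|rewrite lee_fin].
Qed.

Let devD0 w : (0 <= devD w)%E.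
Proof.
by apply: le_ereal_sup_tmp; exists (dev 0 w)%:E; [exists 0|rewrite lee_fin].
Qed.

Context (S : R) (S0 : 0 <= S) (meanS : forall f, B f -> mean f <= S).

Let devD_le w : (devD w <= peakD w + S%:E)%E.
Proof.
apply: ge_ereal_sup => _ [f Df <-].
apply: le_trans (_ : (peak f w)%:E + S%:E <= _)%E; last first.
  by rewrite leeD2r//; apply: ereal_sup_ubound; exists f.
rewrite -EFinD lee_fin /dev; have h1 := sum_le_peak f w; have h2 := meanS (DB Df).
have h3 := mean0 f; have h4 := peak0 f w.
have h5 : 0 <= m%:R^-1 * \sum_(j < m) `|f (X j w)| `^ p.
  by rewrite mulr_ge0 ?invr_ge0 ?(ltW m0R)// sumr_ge0// => j _; exact: powR_ge0.
by rewrite ler_norml; apply/andP; split; lra.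
Qed.

Let EpeakD : (\int[P]_w peakD w <= Esup P B peak)%E.
Proof. by have [_ <-] := EsupD mpeak peak0; exact: Esup_mono. Qed.

Let EdevD_fin : (Esup P B peak < +oo)%E -> (\int[P]_w devD w)%E \is a fin_num.
Proof.
move=> Bfin; rewrite ge0_fin_numE; last by apply: integral_ge0.
apply: (@le_lt_trans _ _ (\int[P]_w (peakD w + S%:E))%E).
  apply: ge0_le_integral => //.
  by apply: emeasurable_funD.
rewrite ge0_integralD// integral_cst//= probability_setT mule1.
by rewrite lte_add_pinfty ?ltry// (le_lt_trans EpeakD).
Qed.

Context (C1 : R) (C10 : 0 < C1)
  (HC1 : sampling_constant theta p zeta C1).

Let lthm : 0 < ln m%:R `^ theta / m%:R :> R.
Proof. by rewrite divr_gt0// powR_gt0// ln_gt0// ltr1n. Qed.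

(** The deterministic bound at the sample [w]: the peak bounds the values, and the sum of
    their powers is at most [m] times the sum of the deviation and the largest mean. *)
Lemma rademacher_le (t : seq (Om -> R^o)) (l : R) w : (forall f, f \in t -> D f) -> 0 < l ->
  ((\sum_(e : {ffun 'I_m -> bool}) \big[Num.max/0]_(f <- t)
     `|m%:R^-1 * rademacher_sum e (fun j => `|f (X j w)| `^ p)|)%:E <=
   (2 ^+ m * C1)%:E * ((l `^ (theta - 1) * (ln m%:R `^ theta / m%:R))%:E * peakD w +
      l^-1%:E * (devD w + S%:E)))%E.
Proof.
move=> tD l0.
have K0 : (0 < (2 ^+ m * C1)%:E :> \bar R)%E by rewrite lte_fin mulr_gt0// exprn_gt0.
have a0 : (0 < (l `^ (theta - 1) * (ln m%:R `^ theta / m%:R))%:E :> \bar R)%E.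
  by rewrite lte_fin mulr_gt0// powR_gt0.
have b0 : (0 < l^-1%:E :> \bar R)%E by rewrite lte_fin invr_gt0.
have [pE|pfin] := eqVneq (peakD w) +oo%E.
  rewrite pE gt0_muley//; set Y := (l^-1%:E * _)%E.
  have : (0 <= Y)%E by rewrite mule_ge0 ?(ltW b0)// adde_ge0.
  by case: Y => [y| |]// _; rewrite gt0_muley// leey.
have {}pfin : peakD w \is a fin_num by rewrite ge0_fin_numE// ltey.
have dfin : devD w \is a fin_num.
  rewrite ge0_fin_numE// (le_lt_trans (devD_le w))// lte_add_pinfty ?ltry//.
  by rewrite -ge0_fin_numE.
have pw f : D f -> peak f w <= fine (peakD w).
  by move=> Df; rewrite -lee_fin fineK//; apply: ereal_sup_ubound; exists f.
have dw f : D f -> dev f w <= fine (devD w).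
  by move=> Df; rewrite -lee_fin fineK//; apply: ereal_sup_ubound; exists f.
rewrite -(fineK pfin) -(fineK dfin).
rewrite -[leRHS]/((2 ^+ m * C1 * (l `^ (theta - 1) * (ln m%:R `^ theta / m%:R) *
  fine (peakD w) + l^-1 * (fine (devD w) + S)))%:E) lee_fin.
have pw0 : 0 <= fine (peakD w) by exact: fine_ge0.
pose M := fine (peakD w) `^ p^-1.
have Mp : M `^ p = fine (peakD w).
  by rewrite /M -powRrM mulVf ?gt_eqF// powRr1.
have fM f j : D f -> `|f (X j w)| <= M.
  move=> Df; have -> : `|f (X j w)| = `|f (X j w)| `^ p `^ p^-1.
    by rewrite -powRrM divff ?gt_eqF// powRr1.
  apply: ge0_ler_powR; rewrite ?nnegrE ?powR_ge0 ?invr_ge0 ?(ltW p0)//.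
  exact: le_trans (peak_ge f w j) (pw _ Df).
have Dsum f : D f -> \sum_j `|f (X j w)| `^ p <= m%:R * (fine (devD w) + S).
  move=> Df; rewrite -ler_pdivrMl//.
  have := dw f Df; rewrite /dev => /(le_trans (ler_norm _)).
  by have := meanS (DB Df); lra.
have mid f g : D f -> D g -> let h := 2^-1 *: (f + g) in
    [/\ D h, forall j, h (X j w) = (f (X j w) + g (X j w)) / 2 &
      N h <= Num.max (N f) (N g) - zeta * N (f - g) `^ theta].
  move=> Df Dg h; split; first exact: (ratball_mid hL hN sL).
    by move=> j; rewrite mulrC.
  by apply: hNc; [exact: DL|exact: DL|case: Df|case: Dg].
have lip f g j : D f -> D g -> `|f (X j w) - g (X j w)| <= M * N (f - g).
  apply: (ratball_lipschitz hL hN sL (phi := fun f => f (X j w))) => // f' Df'.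
  exact: fM.
have N1 f : D f -> 0 <= N f <= 1.
  move=> Df; have [h0 _ _ _] := hN.
  by apply/andP; split; [apply: h0; exact: DL|case: Df].
have H := HC1 hm D0 (norm_on0 hL hN) (fun j => erefl) N1 mid fM lip Dsum l0 tD.
under eq_bigr => e _.
  under eq_bigr do rewrite normrM (gtr0_norm (_ : 0 < m%:R^-1)) ?invr_gt0//.
  rewrite bigmaxrZ ?invr_ge0 ?(ltW m0R)//; over.
rewrite -mulr_sumr; apply: le_trans (ler_wpM2l _ H) _.
  by rewrite invr_ge0 ltW.
rewrite Mp le_eqVlt; apply/orP; left; apply/eqP; field.
by rewrite !gt_eqF.
Qed.

Context (peak_fin : (Esup P B peak < +oo)%E).

Let avg_peak := fine (Esup P B peak).
Let avg_dev := fine (\int[P]_w devD w)%E.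

Let Efin : Esup P B peak \is a fin_num.
Proof.
rewrite ge0_fin_numE//; apply: le_trans EpeakD; exact: integral_ge0.
Qed.

(** The expected deviation of [D] itself appears on the right, but divided by [l]. *)
Lemma deviation_bound (t : seq (Om -> R^o)) (l : R) : (forall f, f \in t -> D f) -> 0 < l ->
  (\int[P]_w (\big[Num.max/0]_(f <- t) dev f w)%:E <=
   (2 * C1 * (l `^ (theta - 1) * (ln m%:R `^ theta / m%:R * avg_peak) + (avg_dev + S) / l))%:E)%E.
Proof.
move=> tD l0; set J := (\int[P]_w _)%E.
have mt : measurable_fun setT (fun w => (\big[Num.max/0]_(f <- t) dev f w)%:E).
  apply/measurable_EFinP; apply: measurable_bigmax => f ft; apply: mdev.
  exact: DL (tD _ ft).
have Jfin : J \is a fin_num.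
  rewrite ge0_fin_numE; last by apply: integral_ge0 => w _; rewrite lee_fin bigmaxr_ge0.
  apply: (@le_lt_trans _ _ (\int[P]_w devD w)%E); last first.
    by rewrite -ge0_fin_numE ?EdevD_fin//; exact: integral_ge0.
  apply: ge0_le_integral => //; first by move=> w _; rewrite lee_fin bigmaxr_ge0.
  move=> w _; rewrite big_seq; elim/big_ind: _ => // [x y xd yd|f ft].
    by rewrite EFin_max ge_max xd.
  by apply: ereal_sup_ubound; exists f => //; exact: tD.
pose H e w := (\big[Num.max/0]_(f <- t)
  `|m%:R^-1 * rademacher_sum e (fun j => `|f (X j w)| `^ p)|)%:E.
have mH e : measurable_fun setT (H e).
  apply/measurable_EFinP; apply: measurable_bigmax => f ft; apply: measurableT_comp => //.
  apply: measurable_funM => //; apply: measurable_sum => j.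
  by apply: measurable_funM => //; apply: mpowX; exact: DL (tD _ ft).
have H0 e w : (0 <= H e w)%E by rewrite lee_fin bigmaxr_ge0.
have JH e : (J <= 2%:E * \int[P]_w H e w)%E.
  apply: (symmetrization Xindep (h := fun f x => `|f x| `^ p) (c := mean)) => //.
  - by move=> f ft; apply: mpow; exact: DL (tD _ ft).
  - by move=> f j ft; apply: integrable_sample; exact: DL (tD _ ft).
  - by move=> f j ft; apply: mean_sample; exact: DL (tD _ ft).
have JS : (\sum_(e : {ffun 'I_m -> bool}) J <= 2%:E * \int[P]_w \sum_(e : {ffun 'I_m -> bool}) H e w)%E.
  rewrite ge0_integral_sum// ge0_sume_distrr; last by move=> e _; exact: integral_ge0.
  by apply: lee_sum => e _; exact: JH.
have HU : (\int[P]_w \sum_(e : {ffun 'I_m -> bool}) H e w <= (2 ^+ m * C1)%:E *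
   ((l `^ (theta - 1) * (ln m%:R `^ theta / m%:R))%:E * avg_peak%:E + l^-1%:E * (avg_dev%:E + S%:E)))%E.
  have K0 : 0 <= 2 ^+ m * C1 by rewrite mulr_ge0 ?exprn_ge0// ltW.
  have a0 : 0 <= l `^ (theta - 1) * (ln m%:R `^ theta / m%:R).
    by rewrite mulr_ge0 ?powR_ge0// ltW.
  have b0 : 0 <= l^-1 by rewrite invr_ge0 ltW.
  apply: (@le_trans _ _ (\int[P]_w ((2 ^+ m * C1)%:E *
   ((l `^ (theta - 1) * (ln m%:R `^ theta / m%:R))%:E * peakD w +
      l^-1%:E * (devD w + S%:E))))%E).
    apply: ge0_le_integral => //.
    - by move=> w _; exact: sume_ge0.
    - exact: emeasurable_sum.
    - apply: measurable_funeM; apply: emeasurable_funD; apply: measurable_funeM => //.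
      exact: emeasurable_funD.
    - by move=> w _; rewrite sumEFin; exact: rademacher_le.
  have U0 w : (0 <= devD w + S%:E)%E by rewrite adde_ge0.
  have mU : measurable_fun setT (fun w => (devD w + S%:E)%E) by exact: emeasurable_funD.
  rewrite ge0_integralZl//=; last 2 first.
  - by apply: emeasurable_funD; exact: measurable_funeM.
  - by move=> w _; rewrite adde_ge0// mule_ge0.
  rewrite lee_wpmul2l// ge0_integralD//=; last 4 first.
  - by move=> w _; rewrite mule_ge0.
  - exact: measurable_funeM.
  - by move=> w _; rewrite mule_ge0.
  - exact: measurable_funeM.
  rewrite !ge0_integralZl// ge0_integralD// integral_cst//= probability_setT mule1.
  rewrite leeD//.
    by rewrite lee_wpmul2l// fineK.
  by rewrite lee_wpmul2l// leeD2r// fineK ?EdevD_fin.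
move: JS; rewrite -(fineK Jfin) sumEFin sum_signs_const => JS.
have {JS HU} := le_trans JS (lee_wpmul2l (_ : 0 <= 2%:E)%E HU).
rewrite !lee_fin => JS.
have q0 : 0 < 2 ^+ m :> R by rewrite exprn_gt0.
rewrite -(ler_pM2l q0); apply: le_trans (JS _) _ => //.
by rewrite le_eqVlt; apply/orP; left; apply/eqP; ring.
Qed.

(** The deviation of [s] is bounded by that of the countable class [D] containing it,
    because the centres of the cells may lie outside [s] but not outside [D]. *)
Lemma finite_class_bound (a : R) : (avg_peak = 0 -> S = 0) ->
  a = ln m%:R `^ theta / m%:R * avg_peak ->
  (\int[P]_w ereal_sup [set (dev f w)%:E | f in [set` s]] <=
   (2 * (2 * C1) * ((2 * (2 * C1)) `^ (theta - 1) + 2) *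
    (a + a `^ theta^-1 * S `^ (1 - theta^-1)))%:E)%E.
Proof.
move=> eS aE.
have e0 : 0 <= avg_peak by rewrite fine_ge0// (le_trans _ EpeakD)//; exact: integral_ge0.
have a0 : 0 <= a by rewrite aE mulr_ge0// ltW.
have d0 : 0 <= avg_dev by rewrite fine_ge0//; exact: integral_ge0.
have C20 : 0 < 2 * C1 by rewrite mulr_gt0.
have empty_sup : (\int[P]_w ereal_sup [set (dev f w)%:E | f in set0] = -oo)%E.
  under eq_integral do rewrite image_set0 ereal_sup0.
  by rewrite integral_cst//= probability_setT mule1.
have lsup (t : seq (Om -> R^o)) : t != [::] -> forall w,
    (ereal_sup [set (dev f w)%:E | f in [set` t]] = (\big[Num.max/0]_(f <- t) dev f w)%:E)%E.
  case: t => // f0 t _ w.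
  by apply: (ereal_sup_bigmax (f0 := f0)) => //; exact: mem_head.
have dl l : 0 < l -> avg_dev <= 2 * C1 * (l `^ (theta - 1) * a + (avg_dev + S) / l).
  move=> l0; rewrite -lee_fin {1}/avg_dev fineK ?EdevD_fin// -(EsupD mdev dev0).2 aE.
  apply: ge_ereal_sup => _ [F [/finite_seqP[t ->] tD] <-].
  have [->|tn] := eqVneq t [::].
    by rewrite (_ : [set` [::]] = set0) ?empty_sup ?leNye//; apply/seteqP; split.
  under eq_integral do rewrite lsup//.
  by apply: deviation_bound.
have dbound := self_bound htheta C20 a0 S0 d0 _ dl.
have [->|sn] := eqVneq s [::].
  by rewrite (_ : [set` [::]] = set0) ?empty_sup ?leNye//; apply/seteqP; split.
apply: (@le_trans _ _ avg_dev%:E).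
  rewrite /avg_dev fineK ?EdevD_fin// -(EsupD mdev dev0).2.
  apply: ereal_sup_ubound; exists [set` s] => //; split; first exact: finite_seq.
  by move=> f fs; split; [exact: ratspan_gen|case: (sB fs)].
rewrite lee_fin; apply: dbound => /eqP.
rewrite aE mulf_eq0 gt_eqF//= => /eqP; exact: eS.
Qed.

End sampled_class.

Theorem corollary4p7 (R : realType) (theta p zeta : R)
    (htheta : 2 <= theta) (hp : theta <= p) (hzeta : 0 < zeta) :
  exists2 C : R, 0 < C &
  forall (Om : ptopologicalType) (cOm : compact [set: Om])
    (mu : probability (borel Om) R)
    (L : set (Om -> R^o)) (hL : linear_subspace L)
    (hLC : forall f : Om -> R, L f -> continuous f)
    (hLp : forall f : borel Om -> R, L f -> finite_norm mu p%:E f)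
    (B : set (Om -> R^o)) (hB : theta_convex_body L theta zeta B)
    (m : nat) (hm : (1 < m)%N)
    (d : measure_display) (T : measurableType d) (P : probability T R)
    (X : 'I_m -> {RV P >-> borel Om})
    (Xindep : mutually_independent X)
    (Xlaw : forall j D, measurable D -> distribution P (X j) D = mu D),
  let X1 := X (Ordinal (ltnW hm)) in
  let dev (f : Om -> R) (w : T) : R :=
    `| m%:R^-1 * \sum_(j < m) `|f (X j w)| `^ p
       - fine 'N[mu]_p%:E[EFin \o f]%E `^ p | in
  let peak (f : Om -> R) (w : T) : R :=
    \big[Num.max/0]_(j < m) (`|f (X j w)| `^ p) in
  let A : \bar R := ((ln m%:R `^ theta / m%:R)%:E * Esup P B peak)%E in
  let S : \bar R :=
    ereal_sup [set 'E_P[fun w => (`|f (X1 w)| `^ p)%R]%E | f in B] in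
  (Esup P B dev
   <= C%:E * (A + A `^ theta^-1 * S `^ (1 - theta^-1)))%E.
Proof.
have [C1 C10 HC1] := rademacher_sampling_bound htheta hp hzeta.
have C0 : 0 < 2 * (2 * C1) * ((2 * (2 * C1)) `^ (theta - 1) + 2).
  by rewrite mulr_gt0 ?mulr_gt0// ltr_wpDl ?powR_ge0.
exists (2 * (2 * C1) * ((2 * (2 * C1)) `^ (theta - 1) + 2)) => //.
move=> Om _ mu L hL hLC hLp B [N [hN hNc ->]] m hm d T P X Xindep Xlaw.
(* The local definitions of the statement are replaced by names for their values. *)
cbv zeta; set U := [set f | L f /\ N f <= 1]; set X1 := X (Ordinal _).
set dev := (X in (Esup _ _ X <= _)%E); set peak := (X in (_ * Esup _ _ X)%E).
set A := (_%:E * Esup P U peak)%E; set S := (X in (A `^ _ * X `^ _)%E).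
have th0 : 0 < theta by lra.
have lthm : 0 < ln m%:R `^ theta / m%:R :> R.
  by rewrite divr_gt0// ?ltr0n 1?ltnW// powR_gt0// ln_gt0// ltr1n.
have meanE f : U f -> 'E_P[fun w => (`|f (X1 w)| `^ p)%R]%E =
    (fine 'N[mu]_p%:E[EFin \o f]%E `^ p)%:E.
  by move=> [Lf _]; rewrite unlock; exact: (mean_sample htheta hp hLC hLp Xlaw).
have SE : (S <= Esup P U peak)%E.
  apply: ge_ereal_sup => _ [f Uf <-]; rewrite meanE//.
  exact: (mean_le_Esup_peak htheta hp hLC hLp hm Xlaw).
have U0 : U 0.
  by split; [have [] := hL; rewrite inE|rewrite (norm_on0 hL hN)].
have S0 : (0 <= S)%E.
  apply: le_ereal_sup_tmp; exists 'E_P[fun w => (`|(0 : Om -> R^o) (X1 w)| `^ p)%R]%E.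
    by exists 0.
  by rewrite (meanE 0 U0) lee_fin powR_ge0.
have E0 := le_trans S0 SE.
have [Ey|Efin] := eqVneq (Esup P U peak) +oo%E.
  have -> : A = +oo%E by rewrite /A Ey gt0_muley.
  rewrite poweRyr; last by rewrite invr_eq0 gt_eqF.
  rewrite addye ?gt0_muley ?leey//.
  by rewrite -ltNye (lt_le_trans (ltNyr 0))// mule_ge0 ?poweR_ge0// leey.
have {}Efin : (Esup P U peak < +oo)%E by rewrite ltey.
have Enum : Esup P U peak \is a fin_num by rewrite ge0_fin_numE.
have Snum : S \is a fin_num by rewrite ge0_fin_numE// (le_lt_trans SE).
have meanS f : U f -> fine 'N[mu]_p%:E[EFin \o f]%E `^ p <= fine S.
  move=> Uf; rewrite -lee_fin fineK// -meanE//.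
  by apply: ereal_sup_ubound; exists f.
have ES : fine (Esup P U peak) = 0 -> fine S = 0.
  move=> E00; apply/eqP; rewrite eq_le fine_ge0// andbT -E00.
  by rewrite fine_le.
have AE : A = (ln m%:R `^ theta / m%:R * fine (Esup P U peak))%:E.
  by rewrite /A -{1}(fineK Enum).
apply: ge_ereal_sup => _ [F [/finite_seqP[t ->] tU] <-].
rewrite AE -(fineK Snum) !poweR_EFin.
exact: (finite_class_bound htheta hp hL hLC hLp hN hNc hm Xindep Xlaw tU
  (fine_ge0 S0) meanS C10 HC1 Efin ES erefl).
Qed.
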